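(* The high-order compact ADI scheme (S) described in the context, for solving $$\partial_t^{\alpha}v=\lambda_1v_{xx}+\lambda_2v_{yy}-\beta v+F\ \text{ in }\Omega\times(0,T_f],\qquad v(x,y,0)=\tilde\phi(x,y)\ \text{ on }\bar\Omega,\qquad v=\tilde\psi\ \text{ on }\partial\Omega\times(0,T_f],$$ is unconditionally stable; that is, with no condition relating the temporal and spatial step sizes, if $\zeta^i_{m,n}=V^i_{m,n}-\widetilde V^i_{m,n}$ is the difference between the solution $V$ of the scheme and a perturbed solution $\widetilde V$ of it (same source term and boundary data, perturbed initial values, $\zeta$ vanishing at boundary nodes), then $$\|\zeta^{i+1}\|_2\le\|\zeta^0\|_2,\qquad 0\le i\le N_t-1.$$
   Context: Problem data. $\alpha\in(0,1)$, $T_f>0$, $\Omega=(0,L)\times(0,L)$; $\lambda_1,\lambda_2>0$ and $\mu_1,\mu_2,\gamma$ are constants with $\beta:=\frac{\mu_1^2}{4\lambda_1}+\frac{\mu_2^2}{4\lambda_2}-\gamma\ge0$; $F,\tilde\phi,\tilde\psi$ are sufficiently smooth. The Caputo derivative is $\partial_t^\alpha v(x,y,t)=\frac{1}{\Gamma(1-\alpha)}\int_0^t(t-s)^{-\alpha}\frac{\partial v}{\partial s}(x,y,s)\,ds$. Temporal mesh. $N_t,\hat N_t$ are positive integers with $c_0N_t\le\hat N_t\le N_t$ for a fixed constant $c_0\in(0,1)$; $T\in(0,T_f]$; $t_i=T(i/\hat N_t)^\theta$ for $0\le i\le\hat N_t$, with grading parameter $\theta\ge1$; on $[T,T_f]$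 the mesh $T=t_{\hat N_t}<\dots<t_{N_t}=T_f$ is quasiuniform (the ratio of largest to smallest step there is bounded by a fixed constant). Put $\tau_i=t_i-t_{i-1}$, $\eta_i=\tau_{i+1}/\tau_i$, $\sigma=1-\alpha/2$, $t_{i+\sigma}=t_i+\sigma\tau_{i+1}$, $t_{k+1/2}=(t_k+t_{k+1})/2$. Assume $3/4\le\eta_i\le62$ for $1\le i\le N_t-1$, and $\eta_{k-1}^2(\eta_{k-1}+1)\ge\frac{\eta_k}{\eta_k+1}$ for $2\le k\le N_t-1$. L2-1$_\sigma$ coefficients. $r_{i,i}=\frac{\sigma^{1-\alpha}}{\Gamma(2-\alpha)}\tau_{i+1}^{1-\alpha}$ for $i\ge0$; for $i\ge1$, $0\le k\le i-1$, $$r_{i,k}=\frac{1}{\Gamma(1-\alpha)}\int_{t_k}^{t_{k+1}}(t_{i+\sigma}-\nu)^{-\alpha}d\nu,\qquad s_{i,k}=\frac{1}{\Gamma(1-\alpha)}\frac{2}{t_{k+2}-t_k}\int_{t_k}^{t_{k+1}}(t_{i+\sigma}-\nu)^{-\alpha}(\nu-t_{k+1/2})d\nu.$$ $w_{0,0}=\tau_1^{-1}r_{0,0}$, and for $i\ge1$: $w_{i,0}=\tau_1^{-1}(r_{i,0}-s_{i,0})$; $w_{i,k}=\tau_{k+1}^{-1}(r_{i,k}+s_{i,k-1}-s_{i,k})$ for $1\le k\le i-1$; $w_{i,i}=\tau_{i+1}^{-1}(r_{i,i}+s_{i,i-1})$. Spatial mesh. $M_x,M_y$ positive integers, $h_x=L/M_x$,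 $h_y=L/M_y$, $x_m=mh_x$, $y_n=nh_y$. $\delta_x^2g_{m,n}=(g_{m+1,n}-2g_{m,n}+g_{m-1,n})/h_x^2$, $\delta_y^2g_{m,n}=(g_{m,n+1}-2g_{m,n}+g_{m,n-1})/h_y^2$; $\mathcal H_x=I+\frac{h_x^2}{12}\delta_x^2$ for $1\le m\le M_x-1$ and $\mathcal H_x=I$ for $m\in\{0,M_x\}$; $\mathcal H_y=I+\frac{h_y^2}{12}\delta_y^2$ for $1\le n\le M_y-1$ and $\mathcal H_y=I$ for $n\in\{0,M_y\}$. $F^{i+\sigma}_{m,n}=F(x_m,y_n,t_{i+\sigma})$. Scheme (S). With $\mu=\beta\sigma+w_{i,i}$ (depending on $i$), for $1\le m\le M_x-1$, $1\le n\le M_y-1$, $0\le i\le N_t-1$, $$\Big(\mathcal H_x-\tfrac{\sigma\lambda_1}{\mu}\delta_x^2\Big)\Big(\mathcal H_y-\tfrac{\sigma\lambda_2}{\mu}\delta_y^2\Big)V^{i+1}_{m,n}=\frac1\mu\sum_{k=1}^{i}(w_{i,k}-w_{i,k-1})\mathcal H_x\mathcal H_yV^k_{m,n}+\frac{w_{i,0}}{\mu}\mathcal H_x\mathcal H_yV^0_{m,n}-\frac{\beta(1-\sigma)}{\mu}\mathcal H_x\mathcal H_yV^i_{m,n}$$ $$+\frac{1-\sigma}{\mu}(\lambda_1\mathcal H_y\delta_x^2+\lambda_2\mathcal H_x\delta_y^2)V^i_{m,n}+\frac1\mu\mathcal H_x\mathcal H_yF^{i+\sigma}_{m,n}+\frac{\lambda_1\lambda_2\sigma^2}{\mu^2}\delta_x^2\delta_y^2V^i_{m,n},$$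 with $V^0_{m,n}=\tilde\phi(x_m,y_n)$ and $V^{i}_{m,n}=\tilde\psi(x_m,y_n,t_i)$ at boundary nodes, $i\ge1$. Thus $\zeta$ satisfies the same recursion with $V$ replaced by $\zeta$ and the $F$ term removed. Norm. $\|g\|_2^2=\sum_{m=1}^{M_x-1}\sum_{n=1}^{M_y-1}h_xh_y|g_{m,n}|^2$. *)

(* Defs.v *)
From Stdlib Require Import Reals Arith.
From Coquelicot Require Import Coquelicot.
Open Scope R_scope.

Definition Gamma (z : R) : R :=
  RInt_gen (fun x => Rpower x (z - 1) * exp (- x))
           (at_right 0) (Rbar_locally p_infty).

(* [t] gives the time nodes [t 0, ..., t Nt]; [tau t i] is only meant for [1 <= i]. *)
Definition tau (t : nat -> R) (i : nat) : R := t i - t (i - 1)%nat.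

Definition eta (t : nat -> R) (i : nat) : R := tau t (S i) / tau t i.

Definition sig (alpha : R) : R := 1 - alpha / 2.

Definition t_sig (alpha : R) (t : nat -> R) (i : nat) : R :=
  t i + sig alpha * tau t (S i).

Definition t_half (t : nat -> R) (k : nat) : R := (t k + t (S k)) / 2.

Record temporal_mesh (c0 Cq theta T Tf : R) (Nt Nhat : nat) (t : nat -> R)
  : Prop := {
  mesh_Nt_pos   : (0 < Nt)%nat;
  mesh_Nhat_pos : (0 < Nhat)%nat;
  mesh_Nhat_le  : (Nhat <= Nt)%nat;
  mesh_Nhat_ge  : c0 * INR Nt <= INR Nhat;
  mesh_T        : 0 < T <= Tf;
  (* [t 0] is given apart: in the standard library [Rpower 0 theta] is [1]. *)
  mesh_0        : t 0%nat = 0;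
  mesh_graded   : forall i, (1 <= i <= Nhat)%nat ->
                    t i = T * Rpower (INR i / INR Nhat) theta;
  mesh_incr     : forall i, (Nhat <= i < Nt)%nat -> t i < t (S i);
  mesh_end      : t Nt = Tf;
  mesh_quasi    : forall i j, (Nhat < i <= Nt)%nat -> (Nhat < j <= Nt)%nat ->
                    tau t i / tau t j <= Cq
}.

Definition mesh_ratio_conditions (Nt : nat) (t : nat -> R) : Prop :=
  (forall i, (1 <= i <= Nt - 1)%nat -> 3 / 4 <= eta t i <= 62) /\
  (forall k, (2 <= k <= Nt - 1)%nat ->
     eta t (k - 1) ^ 2 * (eta t (k - 1) + 1) >= eta t k / (eta t k + 1)).

(* Coefficients of the L2-1_sigma formula, for [k <= i] only ([k < i] for
   [s_coef]). *)

Definition r_coef (alpha : R) (t : nat -> R) (i k : nat) : R :=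
  if (k =? i)%nat then
    Rpower (sig alpha) (1 - alpha) / Gamma (2 - alpha)
      * Rpower (tau t (S i)) (1 - alpha)
  else
    1 / Gamma (1 - alpha)
      * RInt (fun nu => Rpower (t_sig alpha t i - nu) (- alpha)) (t k) (t (S k)).

Definition s_coef (alpha : R) (t : nat -> R) (i k : nat) : R :=
  1 / Gamma (1 - alpha) * (2 / (t (k + 2)%nat - t k))
    * RInt (fun nu => Rpower (t_sig alpha t i - nu) (- alpha) * (nu - t_half t k))
           (t k) (t (S k)).

Definition w_coef (alpha : R) (t : nat -> R) (i k : nat) : R :=
  / tau t (S k) *
  (if (k =? i)%nat then
     match i with
     | O => r_coef alpha t 0 0
     | S j => r_coef alpha t i i + s_coef alpha t i j
     end
   else
     match k with
     | O => r_coef alpha t i 0 - s_coef alpha t i 0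
     | S j => r_coef alpha t i k + s_coef alpha t i j - s_coef alpha t i k
     end).

(* Only the values [g m n] with [m <= Mx] and [n <= My] matter. *)
Definition grid := nat -> nat -> R.

Definition gplus (f g : grid) : grid := fun m n => f m n + g m n.
Definition gscal (a : R) (g : grid) : grid := fun m n => a * g m n.

(* [dx2] is meaningful for [1 <= m <= Mx - 1] only, and [dy2] for
   [1 <= n <= My - 1] only; the scheme never uses them elsewhere. *)
Definition dx2 (hx : R) (g : grid) : grid := fun m n =>
  (g (m + 1)%nat n - 2 * g m n + g (m - 1)%nat n) / hx ^ 2.
Definition dy2 (hy : R) (g : grid) : grid := fun m n =>
  (g m (n + 1)%nat - 2 * g m n + g m (n - 1)%nat) / hy ^ 2.

Definition Hx (hx : R) (Mx : nat) (g : grid) : grid := fun m n =>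
  if ((1 <=? m) && (m <=? Mx - 1))%nat%bool
  then g m n + hx ^ 2 / 12 * dx2 hx g m n
  else g m n.
Definition Hy (hy : R) (My : nat) (g : grid) : grid := fun m n =>
  if ((1 <=? n) && (n <=? My - 1))%nat%bool
  then g m n + hy ^ 2 / 12 * dy2 hy g m n
  else g m n.

Definition interior (Mx My m n : nat) : Prop :=
  (1 <= m <= Mx - 1)%nat /\ (1 <= n <= My - 1)%nat.

Definition boundary (Mx My m n : nat) : Prop :=
  (m <= Mx)%nat /\ (n <= My)%nat /\ (m = 0%nat \/ m = Mx \/ n = 0%nat \/ n = My).

Definition norm2 (hx hy : R) (Mx My : nat) (g : grid) : R :=
  sqrt (sum_n_m (fun m => sum_n_m (fun n => hx * hy * Rabs (g m n) ^ 2)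
                                  1 (My - 1)) 1 (Mx - 1)).

Definition reaction_coef (lambda1 lambda2 mu1 mu2 gamma : R) : R :=
  mu1 ^ 2 / (4 * lambda1) + mu2 ^ 2 / (4 * lambda2) - gamma.

Definition mu_coef (alpha beta : R) (t : nat -> R) (i : nat) : R :=
  beta * sig alpha + w_coef alpha t i i.

(* The scheme at the node [(m, n)], for the unknown level [V (S i)]. *)
Definition adi_step (alpha lambda1 lambda2 beta hx hy : R) (Mx My : nat)
    (t : nat -> R) (F : R -> R -> R -> R) (V : nat -> grid) (i m n : nat)
  : Prop :=
  let sg := sig alpha in
  let w := w_coef alpha t i in
  let mu := mu_coef alpha beta t i in
  let dx := dx2 hx in
  let dy := dy2 hy in
  let HX := Hx hx Mx in
  let HY := Hy hy My in
  let HH g := HX (HY g) in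
  let Fi : grid := fun p q => F (INR p * hx) (INR q * hy) (t_sig alpha t i) in
  let A g := gplus (HX g) (gscal (- (sg * lambda1 / mu)) (dx g)) in
  let B g := gplus (HY g) (gscal (- (sg * lambda2 / mu)) (dy g)) in
  A (B (V (S i))) m n
  = 1 / mu * sum_n_m (fun k => (w k - w (k - 1)%nat) * HH (V k) m n) 1 i
    + w 0%nat / mu * HH (V 0%nat) m n
    - beta * (1 - sg) / mu * HH (V i) m n
    + (1 - sg) / mu * (lambda1 * HY (dx (V i)) m n + lambda2 * HX (dy (V i)) m n)
    + 1 / mu * HH Fi m n
    + lambda1 * lambda2 * sg ^ 2 / mu ^ 2 * dx (dy (V i)) m n.

Record adi_solution (alpha lambda1 lambda2 beta hx hy : R) (Mx My Nt : nat)
    (t : nat -> R) (F : R -> R -> R -> R) (phi : R -> R -> R)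
    (psi : R -> R -> R -> R) (V : nat -> grid) : Prop := {
  adi_interior : forall i m n, (i <= Nt - 1)%nat -> interior Mx My m n ->
    adi_step alpha lambda1 lambda2 beta hx hy Mx My t F V i m n;
  adi_initial : forall m n, (m <= Mx)%nat -> (n <= My)%nat ->
    V 0%nat m n = phi (INR m * hx) (INR n * hy);
  adi_boundary : forall i m n, (1 <= i <= Nt)%nat -> boundary Mx My m n ->
    V i m n = psi (INR m * hx) (INR n * hy) (t i)
}.

(* Main.v *)
Require Import Defs.
From Stdlib Require Import Reals Arith Lra Lia FunctionalExtensionality.
From Coquelicot Require Import Coquelicot.
Open Scope R_scope.

(** The error zeta solves the scheme with zero source and zero boundary values,
    and every difference operator in it is a polynomial in the two discrete
    Dirichlet Laplacians. The discrete sine modes diagonalise all of them at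
    once, so that each sine coefficient z^k of zeta^k obeys a scalar recursion
      (c w_i + sg K + s) z^(i+1)
        = c (sum_(1 <= k <= i) (w_k - w_(k-1)) z^k + w_0 z^0)
          + (s - (1 - sg) K) z^i
    ([mode_equation], rearranged in [mode_step_bound]). Here w_k = w_(i,k), the
    number c > 0 is the symbol of H_x H_y, K >= 0 collects diffusion and reaction,
    and s >= 0 comes from the splitting term added to factor the operator.

    If the weights w_k are positive and increase with k, the history sum is bounded
    by w_i max |z^k|; since sg >= 1/2, |s - (1 - sg) K| <= s + sg K. The right-hand
    side is thus at most (c w_i + sg K + s) max |z^k|, whence |z^(i+1)| <= |z^0| by
    induction ([implicit_step_bound]). This is done mode by mode because the
    triangle inequality for the norm of the whole grid function would lose the
    constant 1. Parseval's identity ([dst2_parseval]) then turns the bounds on the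
    coefficients into the bound on the norm.

    The increase of the weights is the analytic heart. The kernel
    f(nu) = (t_(i+sg) - nu)^(-alpha) is increasing and convex before t_(i+sg), and
    up to the factor 1 / Gamma(1 - alpha) the weight w_k, for k < i, is its mean
    over [t_k, t_(k+1)], corrected by first moments. The weights interlace with the
    nodal values of the kernel: Gamma(1 - alpha) w_k is at least f(t_k), and for
    k < i it is at most f(t_(k+1)). The lower bound is [kernel_le_w_coef], the upper one
    [w_coef_le_kernel]; only the upper one involves the ratio of consecutive steps.
    For k = i the lower bound compares sg / Gamma(2 - alpha) with
    1 / Gamma(1 - alpha), through the functional equation [Gamma_succ]. *)

(** * Monotonicity from derivatives, and Euler's Gamma function *)

Lemma increment_bounds (f df : R -> R) (a b m M : R) :
  a <= b ->
  (forall x, a <= x <= b -> is_derive f x (df x)) ->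
  (forall x, a <= x <= b -> m <= df x <= M) ->
  m * (b - a) <= f b - f a <= M * (b - a).
Proof.
intros Hab Hd Hm.
destruct (MVT_gen f a b df) as [c [Hc ->]];
  rewrite ?Rmin_left, ?Rmax_right in * by lra.
- intros x Hx. apply Hd. lra.
- intros x Hx. apply continuity_pt_filterlim.
  apply (ex_derive_continuous f). exists (df x). now apply Hd.
- specialize (Hm c Hc). split; apply Rmult_le_compat_r; lra.
Qed.

Lemma increment_le (f g df dg : R -> R) (a b : R) :
  a <= b ->
  (forall x, a <= x <= b -> is_derive f x (df x)) ->
  (forall x, a <= x <= b -> is_derive g x (dg x)) ->
  (forall x, a <= x <= b -> df x <= dg x) ->
  f b - f a <= g b - g a.
Proof.
intros Hab Hf Hg Hle.
destruct (MVT_gen (fun x => g x - f x) a b (fun x => dg x - df x))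
  as [c [Hc Heq]]; rewrite ?Rmin_left, ?Rmax_right in * by lra.
- intros x Hx. apply (is_derive_minus g f); [apply Hg | apply Hf]; lra.
- intros x Hx. apply continuity_pt_filterlim.
  apply (ex_derive_continuous (fun x => g x - f x)).
  exists (dg x - df x). apply (is_derive_minus g f); auto.
- specialize (Hle c Hc).
  assert (0 <= (dg c - df c) * (b - a)) by (apply Rmult_le_pos; lra). lra.
Qed.

(** The limit is the least upper bound; the bound by the limit is kept because
    it is what makes [Gamma] positive. *)
Lemma bounded_increasing_lim (f : R -> R) (a B : R) :
  (forall x y, a <= x <= y -> f x <= f y) ->
  (forall x, a <= x -> f x <= B) ->
  exists l, filterlim f (Rbar_locally p_infty) (locally l) /\
            forall x, a <= x -> f x <= l.
Proof.
intros Hinc Hbd.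
destruct (completeness (fun y => exists x, a <= x /\ y = f x)) as [l [Hub Hlub]].
- exists B. intros y [x [Hx ->]]. auto.
- exists (f a), a. split; [lra | reflexivity].
- assert (Hl : forall x, a <= x -> f x <= l) by (intros x Hx; apply Hub; eauto).
  exists l. split; [|exact Hl].
  apply filterlim_locally. intros eps.
  assert (Hx0 : exists x0, a <= x0 /\ l - eps < f x0).
  { destruct (Classical_Prop.classic (exists x0, a <= x0 /\ l - eps < f x0))
      as [H | H]; [exact H | exfalso].
    assert (l <= l - eps); [|pose proof (cond_pos eps); lra].
    apply Hlub. intros y [x [Hx ->]].
    destruct (Rle_dec (f x) (l - eps)) as [Hle | Hn]; [exact Hle | exfalso].
    apply H. exists x. split; [exact Hx | lra]. }
  destruct Hx0 as [x0 [Hax0 Hx0]].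
  exists x0. intros x Hx.
  specialize (Hinc x0 x). specialize (Hl x).
  change (Rabs (f x - l) < eps). apply Rabs_def1; lra.
Qed.

(** The fundamental theorem of calculus on (0, oo): used both with the
    incomplete Gamma function, to see that Euler's integral converges, and with
    - x^z exp(-x), for the functional equation. *)
Lemma is_RInt_gen_primitive (D d : R -> R) (l0 l1 : R) :
  (forall x, 0 < x -> is_derive D x (d x)) ->
  (forall x, 0 < x -> continuous d x) ->
  filterlim D (at_right 0) (locally l0) ->
  filterlim D (Rbar_locally p_infty) (locally l1) ->
  is_RInt_gen d (at_right 0) (Rbar_locally p_infty) (l1 - l0).
Proof.
intros HD Hd H0 H1.
assert (Hpos : forall P : R -> Prop, (forall x, 0 < x -> P x) ->
  filter_prod (at_right 0) (Rbar_locally p_infty) (fun ab =>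
    forall x, Rmin (fst ab) (snd ab) <= x <= Rmax (fst ab) (snd ab) -> P x)).
{ intros P HP. exists (fun a => 0 < a) (fun b => 0 < b).
  - exists (mkposreal 1 Rlt_0_1). auto.
  - exists 0. auto.
  - intros a b Ha Hb x Hx. simpl in Hx. apply HP.
    assert (0 < Rmin a b) by (apply Rmin_pos; assumption). lra. }
apply is_RInt_gen_ext with (Derive D).
- refine (filter_imp _ _ _ (Hpos (fun x => Derive D x = d x) _)).
  + intros ab H x Hx. apply H. lra.
  + intros x Hx. apply is_derive_unique. auto.
- apply is_RInt_gen_Derive; [| | exact H0 | exact H1]; apply Hpos; intros x Hx.
  + exists (d x). auto.
  + apply continuous_ext_loc with d; [|auto].
    exists (mkposreal x Hx). intros y Hy. symmetry. apply is_derive_unique, HD.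
    apply Rabs_def2 in Hy. simpl in Hy.
    unfold minus, plus, opp in Hy; simpl in Hy. lra.
Qed.

Definition gamma_integrand (z x : R) : R := Rpower x (z - 1) * exp (- x).

Lemma gamma_integrand_pos z x : 0 < gamma_integrand z x.
Proof. apply Rmult_lt_0_compat; apply exp_pos. Qed.

Lemma gamma_integrand_continuous z x : 0 < x -> continuous (gamma_integrand z) x.
Proof.
intros Hx. apply (ex_derive_continuous (gamma_integrand z)).
unfold gamma_integrand, Rpower. auto_derive. exact Hx.
Qed.

Lemma is_derive_Rpower (z x : R) : 0 < x ->
  is_derive (fun x => Rpower x z) x (z * Rpower x (z - 1)).
Proof.
intros Hx. apply is_derive_Reals. now apply derivable_pt_lim_power.
Qed.

Lemma is_derive_Rpower_exp z x : 0 < x ->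
  is_derive (fun x => - (Rpower x z * exp (- x))) x
    (gamma_integrand (z + 1) x - z * gamma_integrand z x).
Proof.
intros Hx. unfold gamma_integrand.
replace (z + 1 - 1) with z by ring.
evar_last.
- apply (is_derive_opp (fun x => Rpower x z * exp (- x))).
  apply (is_derive_mult (fun x => Rpower x z) (fun x => exp (- x))).
  + now apply is_derive_Rpower.
  + auto_derive; [exact I | reflexivity].
  + intros n m. apply Rmult_comm.
- unfold opp, plus, mult; simpl. ring.
Qed.

Lemma Rpower_exp_lim_0 z : 0 < z ->
  filterlim (fun x => - (Rpower x z * exp (- x))) (at_right 0) (locally 0).
Proof.
intros Hz.
replace 0 with (- (0 * 1)) at 2 by ring.
apply (filterlim_comp _ _ _ (fun x => Rpower x z * exp (- x)) Ropp _ (locally (0 * 1)));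
  [|apply (filterlim_opp (0 * 1))].
apply (filterlim_comp_2 (G := locally 0) (H := locally 1)
   (fun x => Rpower x z) (fun x => exp (- x)) Rmult);
  [| |apply (filterlim_mult 0 1)].
- unfold Rpower.
  apply (filterlim_comp _ _ _ (fun x => z * ln x) exp _ (Rbar_locally m_infty));
    [|apply is_lim_exp_m].
  apply (filterlim_comp _ _ _ ln (fun y => z * y) _ (Rbar_locally m_infty));
    [apply is_lim_ln_0|].
  assert (H := filterlim_Rbar_mult_l z m_infty).
  replace (Rbar_mult z m_infty) with m_infty in H; [exact H|].
  simpl. destruct (Rle_dec 0 z) as [H0|H0]; [|lra].
  destruct Rle_lt_or_eq_dec; [reflexivity | lra].
- replace 1 with (exp (- 0)) by (rewrite Ropp_0; apply exp_0).
  apply (filterlim_filter_le_1 (fun x => exp (- x)) (filter_le_within _)).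
  apply (ex_derive_continuous (fun x => exp (- x))). auto_derive. exact I.
Qed.

Lemma Rpower_exp_lim_p z : z <= 1 ->
  filterlim (fun x => - (Rpower x z * exp (- x))) (Rbar_locally p_infty) (locally 0).
Proof.
intros Hz.
apply (filterlim_le_le (F := Rbar_locally p_infty) (fun x => - x * exp (- x))
   _ (fun _ => 0) 0).
- exists 1. intros x Hx.
  assert (0 < exp (- x)) by apply exp_pos.
  assert (0 < Rpower x z) by apply exp_pos.
  assert (Rpower x z <= x).
  { rewrite <- (Rpower_1 x) at 2 by lra. apply Rle_Rpower; lra. }
  split; nra.
- apply (filterlim_comp _ _ _ Ropp (fun y => y * exp y) _ (Rbar_locally m_infty)).
  + apply (filterlim_Rbar_opp p_infty).
  + apply is_lim_mul_exp_m.
- apply filterlim_const.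
Qed.

Definition gamma_primitive (z x : R) : R := RInt (gamma_integrand z) 1 x.

Lemma is_derive_gamma_primitive z x : 0 < x ->
  is_derive (gamma_primitive z) x (gamma_integrand z x).
Proof.
intros Hx.
apply (is_derive_RInt (gamma_integrand z) _ 1);
  [|now apply gamma_integrand_continuous].
exists (mkposreal x Hx). intros y Hy.
apply (RInt_correct (gamma_integrand z)). apply ex_RInt_continuous.
intros u Hu. apply gamma_integrand_continuous.
apply Rabs_def2 in Hy. simpl in Hy.
unfold minus, plus, opp in Hy; simpl in Hy.
assert (0 < Rmin 1 y) by (apply Rmin_pos; lra). lra.
Qed.

Lemma gamma_primitive_increasing z x y : 0 < x <= y ->
  gamma_primitive z x <= gamma_primitive z y.
Proof.
intros Hxy.
assert (H : (fun _ : R => 0) y - (fun _ : R => 0) x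
            <= gamma_primitive z y - gamma_primitive z x); [|simpl in H; lra].
apply (increment_le (fun _ => 0) (gamma_primitive z) (fun _ => 0) (gamma_integrand z));
  [lra| | |].
- intros u _. apply (is_derive_const (0 : R)).
- intros u Hu. apply is_derive_gamma_primitive. lra.
- intros u _. left. apply gamma_integrand_pos.
Qed.

Lemma gamma_primitive_1 z : gamma_primitive z 1 = 0.
Proof. apply (RInt_point 1 (gamma_integrand z)). Qed.

(** For [z <= 1] and [x >= 1] the integrand is below exp(-x). *)
Lemma gamma_primitive_lim_p z : z <= 1 ->
  exists l, filterlim (gamma_primitive z) (Rbar_locally p_infty) (locally l) /\ 0 < l.
Proof.
intros Hz.
destruct (bounded_increasing_lim (gamma_primitive z) 1 1) as [l [Hl Hle]].
- intros x y Hxy. apply gamma_primitive_increasing. lra.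
- intros x Hx.
  assert (H : gamma_primitive z x - gamma_primitive z 1 <= - exp (- x) - - exp (- 1)).
  { apply (increment_le _ (fun x => - exp (- x)) (gamma_integrand z)
             (fun x => exp (- x))); [lra| | |].
    - intros u Hu. apply is_derive_gamma_primitive. lra.
    - intros u Hu. auto_derive; [exact I | ring].
    - intros u Hu. unfold gamma_integrand.
      assert (0 < exp (- u)) by apply exp_pos.
      assert (Rpower u (z - 1) <= 1); [|nra].
      rewrite <- (Rpower_O u) at 2 by lra. apply Rle_Rpower; lra. }
  rewrite gamma_primitive_1 in H.
  assert (0 < exp (- x)) by apply exp_pos.
  assert (exp (- 1) < 1) by (rewrite <- exp_0; apply exp_increasing; lra).
  lra.
- exists l. split; [exact Hl|].
  apply Rlt_le_trans with (gamma_primitive z 2); [|apply Hle; lra].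
  apply RInt_gt_0; [lra | |].
  + intros; apply gamma_integrand_pos.
  + intros; apply gamma_integrand_continuous; lra.
Qed.

(** Near 0 the integrand is below x^(z-1), which has the primitive x^z / z.
    The substitution x = 1 / y reduces this limit to one at infinity. *)
Lemma gamma_primitive_lim_0 z : 0 < z ->
  exists l, filterlim (gamma_primitive z) (at_right 0) (locally l) /\ l <= 0.
Proof.
intros Hz.
destruct (bounded_increasing_lim (fun y => - gamma_primitive z (/ y)) 1 (/ z))
  as [l [Hl Hle]].
- intros x y Hxy. apply Ropp_le_contravar, gamma_primitive_increasing.
  split; [apply Rinv_0_lt_compat; lra | apply Rinv_le_contravar; lra].
- intros y Hy.
  assert (0 < / y) by (apply Rinv_0_lt_compat; lra).
  assert (/ y <= 1) by (rewrite <- Rinv_1; apply Rinv_le_contravar; lra).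
  assert (H1 : gamma_primitive z 1 - gamma_primitive z (/ y)
           <= / z * Rpower 1 z - / z * Rpower (/ y) z).
  { apply (increment_le _ (fun x => / z * Rpower x z) (gamma_integrand z)
             (fun x => Rpower x (z - 1))); [lra| | |].
    - intros u Hu. apply is_derive_gamma_primitive. lra.
    - intros u Hu. replace (Rpower u (z - 1)) with (/ z * (z * Rpower u (z - 1)))
        by (field; lra).
      apply is_derive_scal. apply is_derive_Rpower. lra.
    - intros u Hu. unfold gamma_integrand.
      assert (exp (- u) < 1) by (rewrite <- exp_0; apply exp_increasing; lra).
      assert (0 < Rpower u (z - 1)) by apply exp_pos. nra. }
  rewrite gamma_primitive_1 in H1.
  assert (Rpower 1 z = 1) by (unfold Rpower; rewrite ln_1, Rmult_0_r; apply exp_0).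
  assert (0 < / z) by (apply Rinv_0_lt_compat; lra).
  assert (0 < Rpower (/ y) z) by apply exp_pos. nra.
- exists (- l). split.
  + apply filterlim_within_ext with (fun x => - - gamma_primitive z (/ / x)).
    * intros x Hx. rewrite Rinv_inv. ring.
    * apply (filterlim_comp _ _ _ Rinv (fun y => - - gamma_primitive z (/ y))
               _ (Rbar_locally p_infty) _ filterlim_Rinv_0_right).
      apply (filterlim_comp _ _ _ _ Ropp _ _ _ Hl). apply (filterlim_opp l).
  + specialize (Hle 1). rewrite Rinv_1, gamma_primitive_1 in Hle. lra.
Qed.

Lemma is_RInt_gen_gamma z : 0 < z <= 1 ->
  is_RInt_gen (gamma_integrand z) (at_right 0) (Rbar_locally p_infty) (Gamma z)
  /\ 0 < Gamma z.
Proof.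
intros Hz.
destruct (gamma_primitive_lim_0 z) as [l0 [Hl0 Hl0']]; [lra|].
destruct (gamma_primitive_lim_p z) as [l1 [Hl1 Hl1']]; [lra|].
assert (H : is_RInt_gen (gamma_integrand z) (at_right 0) (Rbar_locally p_infty) (l1 - l0)).
{ apply (is_RInt_gen_primitive (gamma_primitive z)); [| |exact Hl0 | exact Hl1].
  - intros; now apply is_derive_gamma_primitive.
  - intros; now apply gamma_integrand_continuous. }
replace (Gamma z) with (l1 - l0).
- split; [exact H | lra].
- symmetry. apply (is_RInt_gen_unique (gamma_integrand z) (l1 - l0) H).
Qed.

(** Integration by parts, as the integral of the derivative of
    - x^z exp(-x), whose limits at both ends vanish. *)
Lemma Gamma_succ z : 0 < z <= 1 -> Gamma (z + 1) = z * Gamma z.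
Proof.
intros Hz.
destruct (is_RInt_gen_gamma z Hz) as [Hg _].
assert (Hd : is_RInt_gen (fun x => gamma_integrand (z + 1) x - z * gamma_integrand z x)
               (at_right 0) (Rbar_locally p_infty) (0 - 0)).
{ apply (is_RInt_gen_primitive (fun x => - (Rpower x z * exp (- x)))).
  - intros; now apply is_derive_Rpower_exp.
  - intros x Hx. apply (continuous_minus (gamma_integrand (z + 1))).
    + now apply gamma_integrand_continuous.
    + apply (continuous_scal_r z (gamma_integrand z)).
      now apply gamma_integrand_continuous.
  - apply Rpower_exp_lim_0. lra.
  - apply Rpower_exp_lim_p. lra. }
assert (Hs := is_RInt_gen_plus _ _ _ _ Hd (is_RInt_gen_scal _ z _ Hg)).
apply (is_RInt_gen_unique (gamma_integrand (z + 1)) (z * Gamma z)).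
replace (z * Gamma z) with (plus (0 - 0) (scal z (Gamma z)))
  by (unfold plus, scal; simpl; unfold mult; simpl; ring).
revert Hs. apply is_RInt_gen_ext.
apply filter_forall. intros ab x _.
unfold plus, scal; simpl; unfold mult; simpl. ring.
Qed.

(** * The convex kernel of the fractional derivative *)

Definition kernel (alpha c nu : R) : R := Rpower (c - nu) (- alpha).
Definition kernel_slope (alpha c nu : R) : R :=
  alpha * Rpower (c - nu) (- alpha - 1).

Lemma is_derive_kernel alpha c x : x < c ->
  is_derive (kernel alpha c) x (kernel_slope alpha c x).
Proof.
intros Hx. evar_last.
- apply (is_derive_comp (fun y => Rpower y (- alpha)) (fun nu => c - nu)).
  + apply is_derive_Rpower. lra.
  + auto_derive; [exact I | reflexivity].
- unfold kernel_slope, scal; simpl; unfold mult; simpl. ring.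
Qed.

Lemma kernel_slope_increasing alpha c x y : 0 < alpha -> x <= y < c ->
  0 <= kernel_slope alpha c x <= kernel_slope alpha c y.
Proof.
intros Ha Hxy. unfold kernel_slope.
replace (- alpha - 1) with (- (alpha + 1)) by ring.
rewrite !Rpower_Ropp.
assert (0 < Rpower (c - y) (alpha + 1)) by apply exp_pos.
assert (Rpower (c - y) (alpha + 1) <= Rpower (c - x) (alpha + 1))
  by (apply Rle_Rpower_l; lra).
split.
- apply Rmult_le_pos; [lra|]. left. apply Rinv_0_lt_compat. lra.
- apply Rmult_le_compat_l; [lra|]. now apply Rinv_le_contravar.
Qed.

(** The two tangent inequalities that express convexity; all later estimates on
    the kernel are derived from them. *)
Lemma kernel_increment alpha c x y : 0 < alpha -> x <= y < c ->
  kernel_slope alpha c x * (y - x) <= kernel alpha c y - kernel alpha c x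
    <= kernel_slope alpha c y * (y - x).
Proof.
intros Ha Hxy.
apply (increment_bounds _ (kernel_slope alpha c)); [lra| |].
- intros u Hu. apply is_derive_kernel. lra.
- intros u Hu. split; apply kernel_slope_increasing; lra.
Qed.

Lemma kernel_increasing alpha c x y : 0 < alpha -> x <= y < c ->
  kernel alpha c x <= kernel alpha c y.
Proof.
intros Ha Hxy.
destruct (kernel_increment alpha c x y Ha Hxy) as [H _].
destruct (kernel_slope_increasing alpha c x x Ha) as [H0 _]; [lra|].
assert (0 <= kernel_slope alpha c x * (y - x)) by (apply Rmult_le_pos; lra). lra.
Qed.

Lemma is_RInt_kernel alpha c a b : a <= b < c ->
  is_RInt (kernel alpha c) a b (RInt (kernel alpha c) a b).
Proof.
intros Hab. apply (RInt_correct (kernel alpha c)), ex_RInt_continuous.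
intros u Hu. rewrite Rmax_right in Hu by lra.
apply (ex_derive_continuous (kernel alpha c)).
eexists. apply is_derive_kernel. lra.
Qed.

(** The first moment about the midpoint, which appears in the quadratic
    interpolation part of the weights. *)
Definition kernel_moment (alpha c a b : R) : R :=
  RInt (fun nu => kernel alpha c nu * (nu - (a + b) / 2)) a b.

Lemma is_RInt_kernel_moment alpha c a b : a <= b < c ->
  is_RInt (fun nu => kernel alpha c nu * (nu - (a + b) / 2)) a b
    (kernel_moment alpha c a b).
Proof.
intros Hab.
apply (RInt_correct (fun nu => kernel alpha c nu * (nu - (a + b) / 2))),
  ex_RInt_continuous.
intros u Hu. rewrite Rmax_right in Hu by lra.
apply (continuous_mult (kernel alpha c) (fun nu => nu - (a + b) / 2)).
- apply (ex_derive_continuous (kernel alpha c)).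
  eexists. apply is_derive_kernel. lra.
- apply (ex_derive_continuous (fun nu => nu - (a + b) / 2)). auto_derive. exact I.
Qed.

Lemma is_RInt_affine_moment p q a b :
  is_RInt (fun nu => (p + q * (nu - (a + b) / 2)) * (nu - (a + b) / 2)) a b
    (q * (b - a) ^ 3 / 12).
Proof.
evar_last.
- apply (is_RInt_derive
    (fun nu => p * (nu - (a + b) / 2) ^ 2 / 2 + q * (nu - (a + b) / 2) ^ 3 / 3)).
  + intros x _. auto_derive; [exact I | field].
  + intros x _.
    apply (ex_derive_continuous
      (fun nu => (p + q * (nu - (a + b) / 2)) * (nu - (a + b) / 2))).
    auto_derive. exact I.
- unfold minus, plus, opp; simpl. field.
Qed.

(** The kernel is larger on the right half of the interval, where the
    weight is positive. *)
Lemma kernel_moment_nonneg alpha c a b : 0 < alpha -> a <= b < c ->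
  0 <= kernel_moment alpha c a b.
Proof.
intros Ha Hab. set (m := (a + b) / 2).
replace 0 with (0 * (b - a) ^ 3 / 12) by field.
apply (is_RInt_le _ _ a b _ _ (proj1 Hab)
  (is_RInt_affine_moment (kernel alpha c m) 0 a b)
  (is_RInt_kernel_moment alpha c a b Hab)).
intros x Hx. fold m.
destruct (Rle_dec m x) as [Hm | Hm].
- assert (kernel alpha c m <= kernel alpha c x)
    by (apply kernel_increasing; lra). nra.
- assert (kernel alpha c x <= kernel alpha c m)
    by (apply kernel_increasing; unfold m in *; lra). nra.
Qed.

(** The affine function with the value of the kernel at the midpoint and the
    slope of the kernel at [b] lies above the kernel on the right half and below it
    on the left half, so that its moment is larger. *)
Lemma kernel_moment_le alpha c a b : 0 < alpha -> a <= b < c ->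
  kernel_moment alpha c a b <= kernel_slope alpha c b * (b - a) ^ 3 / 12.
Proof.
intros Ha Hab. set (m := (a + b) / 2).
apply (is_RInt_le _ _ a b _ _ (proj1 Hab) (is_RInt_kernel_moment alpha c a b Hab)
  (is_RInt_affine_moment (kernel alpha c m) (kernel_slope alpha c b) a b)).
intros x Hx. fold m.
destruct (Rle_dec m x) as [Hm | Hm].
- destruct (kernel_increment alpha c m x Ha) as [_ H]; [lra|].
  destruct (kernel_slope_increasing alpha c x b Ha) as [_ H']; [lra|].
  apply Rmult_le_compat_r; [lra|].
  apply (Rmult_le_compat_r (x - m)) in H'; lra.
- assert (x <= m < c) by (unfold m in *; lra).
  assert (m <= b) by (unfold m; lra).
  destruct (kernel_increment alpha c x m Ha) as [_ H2]; [lra|].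
  destruct (kernel_slope_increasing alpha c m b Ha) as [_ H']; [lra|].
  rewrite 2!(Rmult_comm _ (x - m)).
  apply Rmult_le_compat_neg_l; [lra|].
  apply (Rmult_le_compat_r (m - x)) in H'; lra.
Qed.

(** The first moment of a constant vanishes, so that the difference of the two
    sides is the integral of (f(nu) - f(a)) (1 - e (nu - mid)), and both factors
    are nonnegative when [e * (b - a) <= 2]. *)
Lemma kernel_integral_ge alpha c a b e : 0 < alpha -> a <= b < c ->
  0 <= e -> e * (b - a) <= 2 ->
  kernel alpha c a * (b - a) + e * kernel_moment alpha c a b
    <= RInt (kernel alpha c) a b.
Proof.
intros Ha Hab He Heb.
assert (H1 : is_RInt (fun nu => kernel alpha c a +
    (e * (kernel alpha c nu * (nu - (a + b) / 2))
     - e * ((kernel alpha c a + 0 * (nu - (a + b) / 2)) * (nu - (a + b) / 2)))) a b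
    ((b - a) * kernel alpha c a
     + (e * kernel_moment alpha c a b - e * (0 * (b - a) ^ 3 / 12)))).
{ apply (is_RInt_plus (fun _ => kernel alpha c a));
    [apply (is_RInt_const (V := R_NormedModule))|].
  apply (is_RInt_minus (fun nu => e * (kernel alpha c nu * (nu - (a + b) / 2)))).
  - apply (is_RInt_scal (fun nu => kernel alpha c nu * (nu - (a + b) / 2))).
    now apply is_RInt_kernel_moment.
  - apply (is_RInt_scal (fun nu =>
      (kernel alpha c a + 0 * (nu - (a + b) / 2)) * (nu - (a + b) / 2))).
    apply is_RInt_affine_moment. }
assert (H := is_RInt_le _ _ a b _ _ (proj1 Hab) H1 (is_RInt_kernel alpha c a b Hab)).
cut (forall x, a < x < b -> kernel alpha c a +
    (e * (kernel alpha c x * (x - (a + b) / 2))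
     - e * ((kernel alpha c a + 0 * (x - (a + b) / 2)) * (x - (a + b) / 2)))
  <= kernel alpha c x).
- intros Hx. specialize (H Hx). lra.
- intros x Hx.
  assert (Hk : kernel alpha c a <= kernel alpha c x) by (apply kernel_increasing; lra).
  assert (e * (x - (a + b) / 2) <= 1) by nra.
  assert (0 <= (kernel alpha c x - kernel alpha c a) * (1 - e * (x - (a + b) / 2)))
    by (apply Rmult_le_pos; lra).
  lra.
Qed.

Lemma kernel_integral_le alpha c a b : 0 < alpha -> a <= b < c ->
  RInt (kernel alpha c) a b
    <= kernel alpha c b * (b - a) - kernel_slope alpha c a * (b - a) ^ 2 / 2.
Proof.
intros Ha Hab.
assert (H : is_RInt
  (fun nu => kernel alpha c b - kernel_slope alpha c a * (b - nu)) a b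
  (kernel alpha c b * (b - a) - kernel_slope alpha c a * (b - a) ^ 2 / 2)).
{ evar_last.
  - apply (is_RInt_derive (fun nu => kernel alpha c b * nu
      + kernel_slope alpha c a * (b - nu) ^ 2 / 2)).
    + intros x _. auto_derive; [exact I | field].
    + intros x _. apply (ex_derive_continuous
        (fun nu => kernel alpha c b - kernel_slope alpha c a * (b - nu))).
      auto_derive. exact I.
  - unfold minus, plus, opp; simpl. field. }
apply (is_RInt_le _ _ a b _ _ (proj1 Hab) (is_RInt_kernel alpha c a b Hab) H).
intros x Hx.
destruct (kernel_increment alpha c x b Ha) as [H1 _]; [lra|].
destruct (kernel_slope_increasing alpha c a x Ha) as [_ H2]; [lra|]. nra.
Qed.

(** The moment over [a, b] is at most d (b - a)^3 / 12, with d the slope at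
    [b], while on [b, e] the mean of the kernel stays below its final value by at
    least d (e - b) / 2. With v = (e - b) / (b - a) the latter absorbs the former
    as soon as 3 v^2 (1 + v) >= 1; v >= 3/4 is enough. *)
Lemma kernel_moment_absorbed alpha c a b e : 0 < alpha ->
  a < b -> b < e < c -> 3 / 4 * (b - a) <= e - b ->
  RInt (kernel alpha c) b e + 2 / (e - a) * kernel_moment alpha c a b
    <= kernel alpha c e * (e - b).
Proof.
intros Ha Hab Hbe Hratio.
assert (H1 := kernel_moment_le alpha c a b Ha).
assert (H2 := kernel_integral_le alpha c b e Ha).
assert (H3 : 0 <= kernel_slope alpha c b)
  by (apply (kernel_slope_increasing alpha c b b); lra).
set (d := kernel_slope alpha c b) in *.
cut (2 / (e - a) * kernel_moment alpha c a b <= d * (e - b) ^ 2 / 2).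
{ intros H4. specialize (H2 ltac:(lra)). lra. }
apply Rle_trans with (2 / (e - a) * (d * (b - a) ^ 3 / 12)).
- apply Rmult_le_compat_l; [|apply H1; lra].
  left. apply Rdiv_lt_0_compat; lra.
- cut ((b - a) ^ 3 <= 3 * (e - b) ^ 2 * (e - a)).
  + intros H4. apply Rmult_le_reg_l with (6 * (e - a)); [lra|].
    replace (6 * (e - a) * (2 / (e - a) * (d * (b - a) ^ 3 / 12)))
      with (d * (b - a) ^ 3) by (field; lra).
    nra.
  + set (u := b - a) in *. replace (e - a) with (e - b + u) by (unfold u; ring).
    set (v := e - b) in *. assert (0 < u) by (unfold u; lra).
    assert (9 / 16 * u ^ 2 <= v ^ 2) by nra.
    apply Rle_trans with (3 * (9 / 16 * u ^ 2) * (7 / 4 * u)); [nra|].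
    apply Rmult_le_compat; nra.
Qed.

(** * Positivity and monotonicity of the weights *)

Lemma Gamma_pos_shifted alpha : 0 < alpha < 1 -> 0 < Gamma (1 - alpha).
Proof. intros Ha. apply is_RInt_gen_gamma. lra. Qed.

Lemma t_sig_gt alpha t i : 0 < alpha < 1 -> t i < t (S i) -> t i < t_sig alpha t i.
Proof.
intros Ha Hi. unfold t_sig, sig, tau.
replace (S i - 1)%nat with i by lia. nra.
Qed.

Lemma tau_S t k : tau t (S k) = t (S k) - t k.
Proof. unfold tau. now replace (S k - 1)%nat with k by lia. Qed.

Lemma increasing_le (t : nat -> R) n k j :
  (forall l, (l < n)%nat -> t l < t (S l)) -> (k <= j <= n)%nat -> t k <= t j.
Proof.
intros Hinc [Hkj Hjn]. induction Hkj as [|j Hkj IH]; [lra|].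
specialize (Hinc j). specialize (IH ltac:(lia)). specialize (Hinc ltac:(lia)). lra.
Qed.

Lemma r_coef_history alpha t i k : (k < i)%nat ->
  r_coef alpha t i k
  = / Gamma (1 - alpha) * RInt (kernel alpha (t_sig alpha t i)) (t k) (t (S k)).
Proof.
intros Hk. unfold r_coef. rewrite (proj2 (Nat.eqb_neq k i)) by lia.
unfold Rdiv. now rewrite Rmult_1_l.
Qed.

Lemma s_coef_moment alpha t i k :
  s_coef alpha t i k
  = / Gamma (1 - alpha) * (2 / (t (S (S k)) - t k)
      * kernel_moment alpha (t_sig alpha t i) (t k) (t (S k))).
Proof.
unfold s_coef. replace (k + 2)%nat with (S (S k)) by lia.
unfold kernel_moment, kernel, t_half. unfold Rdiv at 1. ring.
Qed.

Lemma s_coef_nonneg alpha t i k : 0 < alpha < 1 -> (k < i)%nat ->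
  (forall l, (l <= i)%nat -> t l < t (S l)) -> 0 <= s_coef alpha t i k.
Proof.
intros Ha Hk Hinc. rewrite s_coef_moment.
assert (Hk1 := Hinc k ltac:(lia)). assert (Hk2 := Hinc (S k) ltac:(lia)).
assert (t (S k) <= t i)
  by (apply (increasing_le t i); [intros; apply Hinc; lia | lia]).
assert (t i < t_sig alpha t i) by (apply t_sig_gt; auto).
apply Rmult_le_pos.
- left. now apply Rinv_0_lt_compat, Gamma_pos_shifted.
- apply Rmult_le_pos.
  + left. apply Rdiv_lt_0_compat; lra.
  + apply kernel_moment_nonneg; lra.
Qed.

(** The local part of the last weight is sg / (1 - alpha) times the value of
    the kernel at [t i], over Gamma(1 - alpha), and sg = 1 - alpha / 2 >= 1 - alpha. *)
Lemma r_coef_last alpha t i : 0 < alpha < 1 -> t i < t (S i) ->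
  / Gamma (1 - alpha) * kernel alpha (t_sig alpha t i) (t i)
    <= / tau t (S i) * r_coef alpha t i i.
Proof.
intros Ha Hi. unfold r_coef. rewrite Nat.eqb_refl.
assert (HG := Gamma_pos_shifted alpha Ha).
replace (2 - alpha) with (1 - alpha + 1) by ring.
rewrite Gamma_succ by lra.
assert (Htau : 0 < tau t (S i)) by (rewrite tau_S; lra).
assert (Hs : 0 < sig alpha) by (unfold sig; lra).
unfold kernel, t_sig.
replace (t i + sig alpha * tau t (S i) - t i) with (sig alpha * tau t (S i)) by ring.
rewrite <- Rpower_mult_distr by assumption.
replace (1 - alpha) with (1 + - alpha) at 2 5 by ring.
rewrite !Rpower_plus, !Rpower_1 by assumption.
assert (Hp : 0 < Rpower (sig alpha) (- alpha) * Rpower (tau t (S i)) (- alpha))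
  by (apply Rmult_lt_0_compat; apply exp_pos).
set (p := Rpower (sig alpha) (- alpha)) in *.
set (q := Rpower (tau t (S i)) (- alpha)) in *.
replace (/ tau t (S i) * (sig alpha * p / ((1 - alpha) * Gamma (1 - alpha))
           * (tau t (S i) * q)))
  with (/ Gamma (1 - alpha) * (sig alpha / (1 - alpha) * (p * q)))
  by (field; repeat split; lra).
apply Rmult_le_compat_l; [left; now apply Rinv_0_lt_compat|].
assert (1 <= sig alpha / (1 - alpha)).
{ apply Rmult_le_reg_r with (1 - alpha); [lra|].
  unfold Rdiv. rewrite Rmult_assoc, Rinv_l by lra. unfold sig. lra. }
nra.
Qed.

(** For k < i, the moment of the preceding interval only helps, and the moment of the interval
    itself costs no more than the excess of the mean over the left nodal value. *)
Lemma kernel_le_w_coef alpha t i k : 0 < alpha < 1 -> (k <= i)%nat ->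
  (forall l, (l <= i)%nat -> t l < t (S l)) ->
  / Gamma (1 - alpha) * kernel alpha (t_sig alpha t i) (t k) <= w_coef alpha t i k.
Proof.
intros Ha Hk Hinc.
assert (Hk1 := Hinc k ltac:(lia)).
assert (Htau : 0 < / tau t (S k)) by (apply Rinv_0_lt_compat; rewrite tau_S; lra).
unfold w_coef.
destruct (Nat.eqb_spec k i) as [-> | Hki].
- apply Rle_trans with (/ tau t (S i) * r_coef alpha t i i).
  + now apply r_coef_last.
  + apply Rmult_le_compat_l; [lra|].
    destruct i as [|j]; [lra|].
    assert (0 <= s_coef alpha t (S j) j) by (apply s_coef_nonneg; auto). lra.
- apply Rle_trans with (/ tau t (S k) * (r_coef alpha t i k - s_coef alpha t i k)).
  + assert (HG := Gamma_pos_shifted alpha Ha).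
    rewrite r_coef_history, s_coef_moment by lia.
    assert (Hk2 := Hinc (S k) ltac:(lia)).
    assert (t (S k) <= t i)
      by (apply (increasing_le t i); [intros; apply Hinc; lia | lia]).
    assert (t i < t_sig alpha t i) by (apply t_sig_gt; auto).
    assert (H1 := kernel_integral_ge alpha (t_sig alpha t i) (t k) (t (S k))
              (2 / (t (S (S k)) - t k))).
    rewrite <- Rmult_minus_distr_l, <- Rmult_assoc, (Rmult_comm (/ tau t (S k))),
      Rmult_assoc.
    apply Rmult_le_compat_l; [left; now apply Rinv_0_lt_compat|].
    apply Rmult_le_reg_l with (tau t (S k)); [rewrite tau_S; lra|].
    rewrite <- Rmult_assoc, Rinv_r by (rewrite tau_S; lra).
    rewrite tau_S.
    cut (kernel alpha (t_sig alpha t i) (t k) * (t (S k) - t k) +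
      2 / (t (S (S k)) - t k) * kernel_moment alpha (t_sig alpha t i) (t k) (t (S k)) <=
      RInt (kernel alpha (t_sig alpha t i)) (t k) (t (S k))); [lra|].
    apply H1; try lra.
    * left. apply Rdiv_lt_0_compat; lra.
    * apply Rmult_le_reg_r with (t (S (S k)) - t k); [lra|].
      replace (2 / (t (S (S k)) - t k) * (t (S k) - t k) * (t (S (S k)) - t k))
        with (2 * (t (S k) - t k)) by (field; lra). lra.
  + apply Rmult_le_compat_l; [lra|].
    destruct k as [|j]; [lra|].
    assert (0 <= s_coef alpha t i j) by (apply s_coef_nonneg; auto; lia). lra.
Qed.

(** Here the moment of the interval itself helps, and that of the preceding
    interval is absorbed by the condition on the step ratio. *)
Lemma w_coef_le_kernel alpha t i k : 0 < alpha < 1 -> (k < i)%nat ->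
  (forall l, (l <= i)%nat -> t l < t (S l)) ->
  (forall l, (1 <= l < i)%nat -> 3 / 4 <= eta t l) ->
  w_coef alpha t i k
    <= / Gamma (1 - alpha) * kernel alpha (t_sig alpha t i) (t (S k)).
Proof.
intros Ha Hk Hinc Heta.
assert (Hk1 := Hinc k ltac:(lia)).
assert (HG := Gamma_pos_shifted alpha Ha).
assert (HG' : 0 < / Gamma (1 - alpha)) by now apply Rinv_0_lt_compat.
assert (Hs := s_coef_nonneg alpha t i k Ha Hk Hinc).
assert (t (S k) <= t i)
  by (apply (increasing_le t i); [intros; apply Hinc; lia | lia]).
assert (t i < t_sig alpha t i) by (apply t_sig_gt; auto).
unfold w_coef. rewrite (proj2 (Nat.eqb_neq k i)) by lia.
apply Rmult_le_reg_l with (tau t (S k)); [rewrite tau_S; lra|].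
rewrite <- Rmult_assoc, Rinv_r by (rewrite tau_S; lra).
rewrite Rmult_1_l, tau_S.
destruct k as [|j].
- rewrite r_coef_history by lia.
  assert (H1 := kernel_integral_le alpha (t_sig alpha t i) (t 0%nat) (t 1%nat)
                  ltac:(lra) ltac:(lra)).
  destruct (kernel_slope_increasing alpha (t_sig alpha t i) (t 0%nat) (t 0%nat))
    as [H2 _]; [lra | lra |].
  assert (H3 : RInt (kernel alpha (t_sig alpha t i)) (t 0%nat) (t 1%nat)
    <= kernel alpha (t_sig alpha t i) (t 1%nat) * (t 1%nat - t 0%nat)).
  { set (d := kernel_slope alpha (t_sig alpha t i) (t 0%nat)) in *.
    assert (0 <= d * (t 1%nat - t 0%nat) ^ 2)
      by (apply Rmult_le_pos; [exact H2 | apply pow2_ge_0]).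
    lra. }
  apply (Rmult_le_compat_l (/ Gamma (1 - alpha))) in H3; lra.
- rewrite r_coef_history, (s_coef_moment _ _ _ j) by lia.
  assert (Hj := Hinc j ltac:(lia)).
  assert (He : 3 / 4 * (t (S j) - t j) <= t (S (S j)) - t (S j)).
  { specialize (Heta (S j) ltac:(lia)). unfold eta in Heta. rewrite !tau_S in Heta.
    apply (Rmult_le_compat_r (t (S j) - t j)) in Heta; [|lra].
    unfold Rdiv in Heta. rewrite (Rmult_assoc (t (S (S j)) - t (S j))), Rinv_l in Heta
      by lra. lra. }
  assert (H1 := kernel_moment_absorbed alpha (t_sig alpha t i) (t j) (t (S j))
                  (t (S (S j))) ltac:(lra) ltac:(lra) ltac:(lra) He).
  apply (Rmult_le_compat_l (/ Gamma (1 - alpha))) in H1; lra.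
Qed.

Lemma w_coef_increasing alpha t i k : 0 < alpha < 1 -> (k < i)%nat ->
  (forall l, (l <= i)%nat -> t l < t (S l)) ->
  (forall l, (1 <= l < i)%nat -> 3 / 4 <= eta t l) ->
  w_coef alpha t i k <= w_coef alpha t i (S k).
Proof.
intros Ha Hk Hinc Heta.
apply Rle_trans with
  (/ Gamma (1 - alpha) * kernel alpha (t_sig alpha t i) (t (S k))).
- now apply w_coef_le_kernel.
- now apply kernel_le_w_coef.
Qed.

Lemma w_coef_pos alpha t i k : 0 < alpha < 1 -> (k <= i)%nat ->
  (forall l, (l <= i)%nat -> t l < t (S l)) -> 0 < w_coef alpha t i k.
Proof.
intros Ha Hk Hinc.
apply Rlt_le_trans with (2 := kernel_le_w_coef alpha t i k Ha Hk Hinc).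
apply Rmult_lt_0_compat; [now apply Rinv_0_lt_compat, Gamma_pos_shifted|].
apply exp_pos.
Qed.

Lemma temporal_mesh_increasing c0 Cq theta T Tf Nt Nhat t : 1 <= theta ->
  temporal_mesh c0 Cq theta T Tf Nt Nhat t ->
  forall l, (l < Nt)%nat -> t l < t (S l).
Proof.
intros Hth Hm l Hl.
destruct (Nat.lt_ge_cases l Nhat) as [Hlt | Hge]; [|now apply (mesh_incr _ _ _ _ _ _ _ _ Hm)].
assert (HT := mesh_T _ _ _ _ _ _ _ _ Hm).
assert (HN : 0 < INR Nhat) by (apply lt_0_INR, (mesh_Nhat_pos _ _ _ _ _ _ _ _ Hm)).
rewrite (mesh_graded _ _ _ _ _ _ _ _ Hm (S l)) by lia.
destruct l as [|j].
- rewrite (mesh_0 _ _ _ _ _ _ _ _ Hm).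
  apply Rmult_lt_0_compat; [lra | apply exp_pos].
- rewrite (mesh_graded _ _ _ _ _ _ _ _ Hm (S j)) by lia.
  apply Rmult_lt_compat_l; [lra|]. apply Rlt_Rpower_l; [lra|]. split.
  + apply Rdiv_lt_0_compat; [apply lt_0_INR; lia | exact HN].
  + apply Rmult_lt_compat_r; [now apply Rinv_0_lt_compat|]. apply lt_INR. lia.
Qed.

(** * Finite sums *)

(** Sums over the interior indices 1, ..., N, fixed to real values so that
    [ring] and [lra] apply. *)
Definition Sum (N : nat) (f : nat -> R) : R := sum_n_m f 1 N.

Lemma Sum_0 f : Sum 0 f = 0.
Proof. apply (sum_n_m_zero f). lia. Qed.

Lemma Sum_S N f : Sum (S N) f = Sum N f + f (S N).
Proof. apply (sum_n_Sm f). lia. Qed.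

Lemma Sum_ext N f g : (forall k, (1 <= k <= N)%nat -> f k = g k) -> Sum N f = Sum N g.
Proof. apply (sum_n_m_ext_loc f g). Qed.

Lemma Sum_plus N f g : Sum N (fun k => f k + g k) = Sum N f + Sum N g.
Proof. apply (sum_n_m_plus f g). Qed.

Lemma Sum_scal N c f : Sum N (fun k => c * f k) = c * Sum N f.
Proof. apply (sum_n_m_mult_l c f). Qed.

Lemma Sum_eq_0 N f : (forall k, (1 <= k <= N)%nat -> f k = 0) -> Sum N f = 0.
Proof.
intros H. rewrite (Sum_ext N f (fun k => 0 * f k)).
- rewrite Sum_scal. ring.
- intros k Hk. rewrite H by exact Hk. ring.
Qed.

Lemma Sum_switch M N (f : nat -> nat -> R) :
  Sum M (fun m => Sum N (fun n => f m n)) = Sum N (fun n => Sum M (fun m => f m n)).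
Proof.
induction M as [|M IH].
- rewrite Sum_0. symmetry. apply Sum_eq_0. intros; apply Sum_0.
- rewrite Sum_S, IH, <- Sum_plus. apply Sum_ext. intros. now rewrite Sum_S.
Qed.

Lemma Sum_le N f g : (forall k, (1 <= k <= N)%nat -> f k <= g k) -> Sum N f <= Sum N g.
Proof.
induction N as [|N IH]; intros H; [rewrite !Sum_0; lra|].
rewrite !Sum_S. apply Rplus_le_compat; [apply IH; intros|]; apply H; lia.
Qed.

Lemma Sum_only N j f : (1 <= j <= N)%nat ->
  (forall k, (1 <= k <= N)%nat -> k <> j -> f k = 0) -> Sum N f = f j.
Proof.
induction N as [|N IH]; intros Hj H; [lia|].
rewrite Sum_S. destruct (Nat.eq_dec j (S N)) as [-> | Hne].
- rewrite Sum_eq_0; [ring|]. intros k Hk. apply H; lia.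
- rewrite IH, (H (S N)); [ring | lia.. |]. intros; apply H; lia.
Qed.

(** * The scalar recursion *)

(** The coefficients w_k - w_(k-1) and w_0 are nonnegative and telescope to
    w_i. *)
Lemma weighted_history_bound (w z : nat -> R) (B : R) (i : nat) :
  0 <= w 0%nat -> (forall k, (k < i)%nat -> w k <= w (S k)) ->
  (forall k, (k <= i)%nat -> Rabs (z k) <= B) ->
  Rabs (Sum i (fun k => (w k - w (k - 1)%nat) * z k) + w 0%nat * z 0%nat) <= w i * B.
Proof.
intros Hw0. induction i as [|i IH]; intros Hw Hz.
- rewrite Sum_0, Rplus_0_l, Rabs_mult, (Rabs_pos_eq (w 0%nat)) by exact Hw0.
  apply Rmult_le_compat_l; auto.
- rewrite Sum_S. replace (S i - 1)%nat with i by lia.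
  specialize (IH ltac:(intros; apply Hw; lia) ltac:(intros; apply Hz; lia)).
  specialize (Hw i ltac:(lia)). specialize (Hz (S i) ltac:(lia)).
  assert (H : Rabs ((w (S i) - w i) * z (S i)) <= (w (S i) - w i) * B).
  { rewrite Rabs_mult, (Rabs_pos_eq (w (S i) - w i)) by lra.
    apply Rmult_le_compat_l; lra. }
  assert (Ht := Rabs_triang
    (Sum i (fun k => (w k - w (k - 1)%nat) * z k) + w 0%nat * z 0%nat)
    ((w (S i) - w i) * z (S i))).
  replace (Sum i (fun k => (w k - w (k - 1)%nat) * z k) + (w (S i) - w i) * z (S i)
    + w 0%nat * z 0%nat) with
    (Sum i (fun k => (w k - w (k - 1)%nat) * z k) + w 0%nat * z 0%nat
    + (w (S i) - w i) * z (S i)) by ring.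
  lra.
Qed.

(** The condition 1/2 <= sg is used in (1 - sg) K <= sg K, which lets the
    implicit side dominate the explicit one. *)
Lemma implicit_step_bound (c sg K s A y z B : R) :
  0 < c -> 1 / 2 <= sg <= 1 -> 0 <= K -> 0 <= s ->
  Rabs A <= c * B -> Rabs z <= B ->
  (c + sg * K + s) * y = A + (s - (1 - sg) * K) * z ->
  Rabs y <= B.
Proof.
intros Hc Hsg HK Hs HA Hz Heq.
assert (HsK : 0 <= sg * K) by (apply Rmult_le_pos; lra).
assert (HsK' : 0 <= (1 - sg) * K <= sg * K)
  by (split; [apply Rmult_le_pos | apply Rmult_le_compat_r]; lra).
apply Rmult_le_reg_l with (c + sg * K + s); [lra|].
rewrite <- (Rabs_pos_eq (c + sg * K + s)) at 1 by lra.
rewrite <- Rabs_mult, Heq.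
apply Rle_trans with (1 := Rabs_triang _ _). rewrite Rabs_mult.
assert (Rabs (s - (1 - sg) * K) <= sg * K + s) by (apply Rabs_le; lra).
assert (Rabs (s - (1 - sg) * K) * Rabs z <= (sg * K + s) * B)
  by (apply Rmult_le_compat; auto using Rabs_pos).
lra.
Qed.

(** * The discrete sine transform on an interval *)

Definition mode (M p m : nat) : R := sin (INR p * INR m * (PI / INR M)).

Lemma mode_0 M p : mode M p 0 = 0.
Proof. unfold mode. simpl (INR 0). rewrite Rmult_0_r, Rmult_0_l. apply sin_0. Qed.

Lemma sin_INR_PI j : sin (INR j * PI) = 0.
Proof. apply sin_eq_0_1. exists (Z.of_nat j). now rewrite INR_IZR_INZ. Qed.

Lemma mode_last M p : (0 < M)%nat -> mode M p M = 0.
Proof.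
intros HM. unfold mode.
replace (INR p * INR M * (PI / INR M)) with (INR p * PI)
  by (field; apply not_0_INR; lia).
apply sin_INR_PI.
Qed.

Lemma mode_recurrence M p m :
  mode M p (S (S m)) + mode M p m
  = 2 * cos (INR p * (PI / INR M)) * mode M p (S m).
Proof.
unfold mode. rewrite !S_INR. set (x := PI / INR M).
replace (INR p * (INR m + 1 + 1) * x)
  with (INR p * (INR m + 1) * x + INR p * x) by ring.
replace (INR p * INR m * x) with (INR p * (INR m + 1) * x - INR p * x) by ring.
rewrite sin_plus, sin_minus. ring.
Qed.

(** Telescoping: 2 sin(x/2) cos(p x) = sin((p + 1/2) x) - sin((p - 1/2) x). *)
Lemma Sum_cos N x :
  2 * sin (x / 2) * Sum N (fun p => cos (INR p * x))
  = sin ((INR N + 1 / 2) * x) - sin (x / 2).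
Proof.
induction N as [|N IH].
- rewrite Sum_0. simpl INR. replace ((0 + 1 / 2) * x) with (x / 2) by field. ring.
- rewrite Sum_S, Rmult_plus_distr_l, IH, S_INR.
  replace ((INR N + 1 + 1 / 2) * x) with ((INR N + 1) * x + x / 2) by field.
  replace ((INR N + 1 / 2) * x) with ((INR N + 1) * x - x / 2) by field.
  rewrite sin_plus, sin_minus. ring.
Qed.

(** On the grid the sum depends on [J] through its parity only. [J] is real
    because differences of indices occur. *)
Lemma Sum_cos_grid M J : 0 < J < 2 * INR M -> (0 < M)%nat -> sin (J * PI) = 0 ->
  Sum (M - 1) (fun p => cos (INR p * (J * (PI / INR M)))) = - (1 + cos (J * PI)) / 2.
Proof.
intros HJ HM Hsin. set (x := J * (PI / INR M)).
assert (HM0 : INR M <> 0) by (apply not_0_INR; lia).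
assert (Hx : 0 < sin (x / 2)).
{ assert (HPI := PI_RGT_0). assert (0 < INR M) by (apply lt_0_INR; lia).
  replace (x / 2) with (J / (2 * INR M) * PI) by (unfold x; field; exact HM0).
  assert (0 < J / (2 * INR M) < 1).
  { split; [apply Rdiv_lt_0_compat; lra|].
    apply Rmult_lt_reg_r with (2 * INR M); [lra|].
    unfold Rdiv. rewrite Rmult_assoc, Rinv_l; lra. }
  apply sin_gt_0; nra. }
assert (H := Sum_cos (M - 1) x).
rewrite minus_INR in H by lia. simpl (INR 1) in H.
replace ((INR M - 1 + 1 / 2) * x) with (J * PI - x / 2) in H
  by (unfold x; field; exact HM0).
rewrite sin_minus, Hsin in H.
apply Rmult_eq_reg_l with (2 * sin (x / 2)); [|lra].
rewrite H. field.
Qed.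

(** The product of two sines is half the difference of the cosines of m - m'
    and m + m'; these have the same parity, so that their sums cancel. *)
Lemma mode_orthogonal_lt M m m' : (1 <= m' < m)%nat -> (m <= M - 1)%nat ->
  Sum (M - 1) (fun p => mode M p m * mode M p m') = 0.
Proof.
intros Hm HM.
set (c J := Sum (M - 1) (fun p => cos (INR p * (J * (PI / INR M))))).
assert (H : Sum (M - 1) (fun p => mode M p m * mode M p m')
  = 1 / 2 * (c (INR m - INR m') + - 1 * c (INR m + INR m'))).
{ unfold c. rewrite <- Sum_scal, <- Sum_plus, <- Sum_scal. apply Sum_ext.
  intros p _. unfold mode. set (x := PI / INR M).
  replace (INR p * ((INR m - INR m') * x))
    with (INR p * INR m * x - INR p * INR m' * x) by ring.
  replace (INR p * ((INR m + INR m') * x))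
    with (INR p * INR m * x + INR p * INR m' * x) by ring.
  rewrite cos_plus, cos_minus. field. }
assert (0 < INR m') by (apply lt_0_INR; lia).
assert (INR m' < INR m) by (apply lt_INR; lia).
assert (INR m < INR M) by (apply lt_INR; lia).
rewrite H. unfold c. rewrite !Sum_cos_grid; try lra; try lia.
- rewrite (Rmult_plus_distr_r (INR m)), (Rmult_minus_distr_r (INR m)).
  rewrite cos_plus, cos_minus, !sin_INR_PI. field.
- rewrite Rmult_plus_distr_r, sin_plus, !sin_INR_PI. ring.
- rewrite Rmult_minus_distr_r, sin_minus, !sin_INR_PI. ring.
Qed.

Lemma mode_square_sum M m : (1 <= m <= M - 1)%nat ->
  Sum (M - 1) (fun p => mode M p m * mode M p m) = INR M / 2.
Proof.
intros Hm.
assert (0 < INR m) by (apply lt_0_INR; lia).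
assert (INR m < INR M) by (apply lt_INR; lia).
transitivity (1 / 2 * (Sum (M - 1) (fun _ => 1)
  + - 1 * Sum (M - 1) (fun p => cos (INR p * ((2 * INR m) * (PI / INR M)))))).
- rewrite <- Sum_scal, <- Sum_plus, <- Sum_scal. apply Sum_ext. intros p _.
  unfold mode. set (x := PI / INR M).
  replace (INR p * ((2 * INR m) * x)) with (2 * (INR p * INR m * x)) by ring.
  rewrite cos_2a_sin. field.
- assert (Hs : sin (2 * INR m * PI) = 0)
    by (rewrite Rmult_assoc, sin_2a, sin_INR_PI; ring).
  rewrite Sum_cos_grid by (lra || lia || exact Hs).
  rewrite Rmult_assoc, cos_2a_sin, sin_INR_PI.
  unfold Sum. rewrite sum_n_m_const.
  replace (S (M - 1) - 1)%nat with (M - 1)%nat by lia.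
  rewrite minus_INR by lia. simpl (INR 1). field.
Qed.

(** The discrete sine transform, without normalising factor. *)
Definition dst (M p : nat) (g : nat -> R) : R :=
  Sum (M - 1) (fun m => mode M p m * g m).

Lemma dst_parseval M g :
  Sum (M - 1) (fun p => dst M p g ^ 2) = INR M / 2 * Sum (M - 1) (fun m => g m ^ 2).
Proof.
transitivity (Sum (M - 1) (fun m => Sum (M - 1) (fun m' =>
  g m * g m' * Sum (M - 1) (fun p => mode M p m * mode M p m')))).
- transitivity (Sum (M - 1) (fun p => Sum (M - 1) (fun m => Sum (M - 1) (fun m' =>
    g m * g m' * (mode M p m * mode M p m'))))).
  + apply Sum_ext. intros p _.
    replace (dst M p g ^ 2) with (dst M p g * dst M p g) by ring.
    unfold dst at 1. rewrite Rmult_comm, <- Sum_scal. apply Sum_ext. intros m _.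
    rewrite Rmult_comm. unfold dst. rewrite <- Sum_scal. apply Sum_ext.
    intros m' _. ring.
  + rewrite Sum_switch. apply Sum_ext. intros m _.
    rewrite Sum_switch. apply Sum_ext. intros m' _. apply Sum_scal.
- rewrite <- Sum_scal. apply Sum_ext. intros m Hm.
  rewrite (Sum_only (M - 1) m); [|exact Hm|].
  + rewrite mode_square_sum by exact Hm. ring.
  + intros m' Hm' Hne.
    destruct (Nat.lt_gt_cases m' m) as [[Hlt | Hgt] _]; [exact Hne | |].
    * rewrite mode_orthogonal_lt by lia. ring.
    * rewrite (Sum_ext _ _ (fun p => mode M p m' * mode M p m))
        by (intros; apply Rmult_comm).
      rewrite mode_orthogonal_lt by lia. ring.
Qed.

(** Summation by parts: the boundary terms form a discrete Wronskian. *)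
Lemma Sum_wronskian N (f g : nat -> R) :
  Sum N (fun m => f m * (g (m + 1)%nat + g (m - 1)%nat)
                  - (f (m + 1)%nat + f (m - 1)%nat) * g m)
  = f N * g (S N) - f (S N) * g N - (f 0%nat * g 1%nat - f 1%nat * g 0%nat).
Proof.
induction N as [|N IH]; [rewrite Sum_0; ring|].
rewrite Sum_S, IH. replace (S N + 1)%nat with (S (S N)) by lia.
replace (S N - 1)%nat with N by lia. ring.
Qed.

Definition mode_eigenvalue (M p : nat) (h : R) : R :=
  (2 - 2 * cos (INR p * (PI / INR M))) / h ^ 2.

Lemma mode_eigenvalue_nonneg M p h : h <> 0 -> 0 <= mode_eigenvalue M p h.
Proof.
intros Hh. assert (Hc := COS_bound (INR p * (PI / INR M))).
apply Rmult_le_pos; [lra|]. left. apply Rinv_0_lt_compat.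
rewrite <- Rsqr_pow2. now apply Rsqr_pos_lt.
Qed.

(** The eigenvalue of the averaging operator I + (h^2 / 12) delta^2. *)
Definition compact_symbol (M p : nat) (h : R) : R :=
  1 - h ^ 2 / 12 * mode_eigenvalue M p h.

(** It lies between 2/3 and 1, because h^2 times the eigenvalue is at most 4. *)
Lemma compact_symbol_pos M p h : h <> 0 -> 0 < compact_symbol M p h.
Proof.
intros Hh. assert (Hc := COS_bound (INR p * (PI / INR M))).
unfold compact_symbol, mode_eigenvalue.
replace (h ^ 2 / 12 * ((2 - 2 * cos (INR p * (PI / INR M))) / h ^ 2))
  with ((2 - 2 * cos (INR p * (PI / INR M))) / 12) by (field; exact Hh).
lra.
Qed.

(** The modes vanish at both ends, as [g] does, so that the Wronskian terms
    drop out and the difference can be moved onto the mode. *)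
Lemma dst_second_difference M p h (g : nat -> R) :
  (0 < M)%nat -> g 0%nat = 0 -> g M = 0 ->
  dst M p (fun m => (g (m + 1)%nat - 2 * g m + g (m - 1)%nat) / h ^ 2)
  = - mode_eigenvalue M p h * dst M p g.
Proof.
intros HM H0 H1.
assert (Hw := Sum_wronskian (M - 1) (mode M p) g).
replace (S (M - 1)) with M in Hw by lia.
rewrite H0, H1, mode_0, mode_last in Hw by exact HM.
unfold dst. rewrite <- Sum_scal.
apply Rminus_diag_uniq.
match goal with |- Sum ?N ?f - Sum ?N ?g = 0 =>
  transitivity (Sum N f + - 1 * Sum N g); [ring|] end.
rewrite <- Sum_scal, <- Sum_plus.
transitivity (/ h ^ 2 * Sum (M - 1) (fun m =>
  mode M p m * (g (m + 1)%nat + g (m - 1)%nat)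
  - (mode M p (m + 1)%nat + mode M p (m - 1)%nat) * g m)).
- rewrite <- Sum_scal. apply Sum_ext. intros m Hm.
  destruct m as [|m]; [lia|].
  replace (S m + 1)%nat with (S (S m)) by lia.
  replace (S m - 1)%nat with m by lia.
  rewrite mode_recurrence. unfold mode_eigenvalue, Rdiv. ring.
- rewrite Hw. ring.
Qed.

(** * The scheme in the sine basis of the square *)

Definition dst2 (Mx My p q : nat) (g : grid) : R :=
  dst Mx p (fun m => dst My q (g m)).

Lemma dst2_swap Mx My p q g :
  dst2 Mx My p q g = dst My q (fun n => dst Mx p (fun m => g m n)).
Proof.
unfold dst2, dst.
rewrite (Sum_ext _ _ (fun m => Sum (My - 1) (fun n =>
  mode Mx p m * (mode My q n * g m n)))) by (intros; now rewrite Sum_scal).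
rewrite Sum_switch. apply Sum_ext. intros n _.
rewrite <- Sum_scal. apply Sum_ext. intros m _. ring.
Qed.

Lemma dst_ext M p f g : (forall m, (1 <= m <= M - 1)%nat -> f m = g m) ->
  dst M p f = dst M p g.
Proof. intros H. apply Sum_ext. intros m Hm. now rewrite H. Qed.

(** Only interior values enter the transform, so the equations of the scheme,
    which hold at interior nodes, may be transformed. *)
Lemma dst2_ext Mx My p q f g :
  (forall m n, Defs.interior Mx My m n -> f m n = g m n) ->
  dst2 Mx My p q f = dst2 Mx My p q g.
Proof.
intros H. apply dst_ext. intros m Hm. apply dst_ext. intros n Hn.
apply H. now split.
Qed.

Lemma dst_plus M p f g : dst M p (fun m => f m + g m) = dst M p f + dst M p g.
Proof. unfold dst. rewrite <- Sum_plus. apply Sum_ext. intros. ring. Qed.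

Lemma dst_scal M p a f : dst M p (fun m => a * f m) = a * dst M p f.
Proof. unfold dst. rewrite <- Sum_scal. apply Sum_ext. intros. ring. Qed.

Lemma dst2_plus Mx My p q f g :
  dst2 Mx My p q (fun m n => f m n + g m n)
  = dst2 Mx My p q f + dst2 Mx My p q g.
Proof.
unfold dst2. rewrite <- dst_plus. apply dst_ext. intros. apply dst_plus.
Qed.

Lemma dst2_scal Mx My p q a f :
  dst2 Mx My p q (fun m n => a * f m n) = a * dst2 Mx My p q f.
Proof.
unfold dst2. rewrite <- dst_scal. apply dst_ext. intros. apply dst_scal.
Qed.

Lemma dst2_Sum Mx My p q (c : nat -> R) (g : nat -> grid) i :
  dst2 Mx My p q (fun m n => Sum i (fun k => c k * g k m n))
  = Sum i (fun k => c k * dst2 Mx My p q (g k)).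
Proof.
induction i as [|i IH].
- rewrite Sum_0, (dst2_ext _ _ _ _ _ (fun m n => 0 * g 0%nat m n)).
  + rewrite dst2_scal. ring.
  + intros. rewrite Sum_0. ring.
- rewrite Sum_S, <- IH, <- dst2_scal, <- dst2_plus. apply dst2_ext.
  intros. apply Sum_S.
Qed.

Lemma dst2_parseval Mx My g :
  Sum (Mx - 1) (fun p => Sum (My - 1) (fun q => dst2 Mx My p q g ^ 2))
  = INR Mx / 2 * (INR My / 2)
    * Sum (Mx - 1) (fun m => Sum (My - 1) (fun n => g m n ^ 2)).
Proof.
rewrite Sum_switch. unfold dst2.
rewrite (Sum_ext _ _ (fun q => INR Mx / 2 * Sum (Mx - 1) (fun m => dst My q (g m) ^ 2)))
  by (intros; apply dst_parseval).
rewrite Sum_scal, Sum_switch, Rmult_assoc. f_equal.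
rewrite <- Sum_scal. apply Sum_ext. intros m _. apply dst_parseval.
Qed.

(** Vanishing on two opposite sides only, corners excluded. An
    operator in one direction requires no more than this, and a difference in the
    other direction of a function that vanishes on the whole boundary still has this
    property, so that the operators can be composed. *)
Definition vanishes_x (Mx My : nat) (g : grid) : Prop :=
  forall n, (1 <= n <= My - 1)%nat -> g 0%nat n = 0 /\ g Mx n = 0.
Definition vanishes_y (Mx My : nat) (g : grid) : Prop :=
  forall m, (1 <= m <= Mx - 1)%nat -> g m 0%nat = 0 /\ g m My = 0.

Lemma dst2_dx2 Mx My p q h g : (0 < Mx)%nat -> vanishes_x Mx My g ->
  dst2 Mx My p q (dx2 h g) = - mode_eigenvalue Mx p h * dst2 Mx My p q g.
Proof.
intros HM Hg. rewrite !dst2_swap, <- dst_scal. apply dst_ext. intros n Hn.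
destruct (Hg n Hn) as [H0 H1].
apply (dst_second_difference Mx p h (fun m => g m n)); auto.
Qed.

Lemma dst2_dy2 Mx My p q h g : (0 < My)%nat -> vanishes_y Mx My g ->
  dst2 Mx My p q (dy2 h g) = - mode_eigenvalue My q h * dst2 Mx My p q g.
Proof.
intros HM Hg. unfold dst2. rewrite <- dst_scal. apply dst_ext. intros m Hm.
destruct (Hg m Hm) as [H0 H1].
apply (dst_second_difference My q h (g m)); auto.
Qed.

Lemma inside_true M m : (1 <= m <= M - 1)%nat ->
  ((1 <=? m) && (m <=? M - 1))%nat%bool = true.
Proof.
intros [H1 H2]. apply Nat.leb_le in H1. apply Nat.leb_le in H2. now rewrite H1, H2.
Qed.

Lemma Hx_inside h M g m n : (1 <= m <= M - 1)%nat ->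
  Hx h M g m n = g m n + h ^ 2 / 12 * dx2 h g m n.
Proof. intros H. unfold Hx. now rewrite inside_true. Qed.

Lemma Hy_inside h M g m n : (1 <= n <= M - 1)%nat ->
  Hy h M g m n = g m n + h ^ 2 / 12 * dy2 h g m n.
Proof. intros H. unfold Hy. now rewrite inside_true. Qed.

Lemma dst2_Hx Mx My p q h g : (0 < Mx)%nat -> vanishes_x Mx My g ->
  dst2 Mx My p q (Hx h Mx g) = compact_symbol Mx p h * dst2 Mx My p q g.
Proof.
intros HM Hg.
rewrite (dst2_ext _ _ _ _ _ (fun m n => g m n + h ^ 2 / 12 * dx2 h g m n))
  by (intros m n [Hm Hn]; now apply Hx_inside).
rewrite (dst2_plus Mx My p q g), (dst2_scal _ _ _ _ _ (dx2 h g)), dst2_dx2 by auto.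
unfold compact_symbol. ring.
Qed.

Lemma dst2_Hy Mx My p q h g : (0 < My)%nat -> vanishes_y Mx My g ->
  dst2 Mx My p q (Hy h My g) = compact_symbol My q h * dst2 Mx My p q g.
Proof.
intros HM Hg.
rewrite (dst2_ext _ _ _ _ _ (fun m n => g m n + h ^ 2 / 12 * dy2 h g m n))
  by (intros m n [Hm Hn]; now apply Hy_inside).
rewrite (dst2_plus Mx My p q g), (dst2_scal _ _ _ _ _ (dy2 h g)), dst2_dy2 by auto.
unfold compact_symbol. ring.
Qed.

Definition vanishes (Mx My : nat) (g : grid) : Prop :=
  forall m n, boundary Mx My m n -> g m n = 0.

Lemma vanishes_vanishes_x Mx My g : vanishes Mx My g -> vanishes_x Mx My g.
Proof. intros H n Hn. split; apply H; unfold boundary; lia. Qed.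

Lemma vanishes_vanishes_y Mx My g : vanishes Mx My g -> vanishes_y Mx My g.
Proof. intros H m Hm. split; apply H; unfold boundary; lia. Qed.

Lemma vanishes_x_dy2 Mx My h g : vanishes Mx My g -> vanishes_x Mx My (dy2 h g).
Proof.
intros H n Hn. unfold dy2.
split; rewrite !H by (unfold boundary; lia); unfold Rdiv; ring.
Qed.

Lemma vanishes_y_dx2 Mx My h g : vanishes Mx My g -> vanishes_y Mx My (dx2 h g).
Proof.
intros H n Hn. unfold dx2.
split; rewrite !H by (unfold boundary; lia); unfold Rdiv; ring.
Qed.

Lemma vanishes_x_Hy Mx My h g : vanishes Mx My g -> vanishes_x Mx My (Hy h My g).
Proof.
intros H n Hn. rewrite !Hy_inside by exact Hn.
destruct (vanishes_x_dy2 Mx My h g H n Hn) as [-> ->].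
destruct (vanishes_vanishes_x Mx My g H n Hn) as [-> ->]. split; ring.
Qed.

Lemma vanishes_x_combination Mx My a f g :
  vanishes_x Mx My f -> vanishes_x Mx My g ->
  vanishes_x Mx My (gplus f (gscal a g)).
Proof.
intros Hf Hg n Hn. unfold gplus, gscal.
destruct (Hf n Hn) as [-> ->]. destruct (Hg n Hn) as [-> ->]. split; ring.
Qed.

Lemma dst2_combination Mx My p q a f g :
  dst2 Mx My p q (gplus f (gscal a g))
  = dst2 Mx My p q f + a * dst2 Mx My p q g.
Proof. unfold gplus, gscal. now rewrite dst2_plus, dst2_scal. Qed.

Definition gminus (f g : grid) : grid := fun m n => f m n - g m n.

Lemma grid_ext (f g : grid) : (forall m n, f m n = g m n) -> f = g.
Proof.
intros H. apply functional_extensionality. intros m.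
apply functional_extensionality. apply H.
Qed.

Lemma dx2_minus h f g : dx2 h (gminus f g) = gminus (dx2 h f) (dx2 h g).
Proof. apply grid_ext. intros. unfold gminus, dx2, Rdiv. ring. Qed.

Lemma dy2_minus h f g : dy2 h (gminus f g) = gminus (dy2 h f) (dy2 h g).
Proof. apply grid_ext. intros. unfold gminus, dy2, Rdiv. ring. Qed.

Lemma Hx_minus h M f g : Hx h M (gminus f g) = gminus (Hx h M f) (Hx h M g).
Proof.
apply grid_ext. intros. unfold Hx. rewrite dx2_minus. unfold gminus.
destruct (_ && _)%bool; ring.
Qed.

Lemma Hy_minus h M f g : Hy h M (gminus f g) = gminus (Hy h M f) (Hy h M g).
Proof.
apply grid_ext. intros. unfold Hy. rewrite dy2_minus. unfold gminus.
destruct (_ && _)%bool; ring.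
Qed.

Lemma combination_minus a f f' g g' :
  gplus (gminus f f') (gscal a (gminus g g'))
  = gminus (gplus f (gscal a g)) (gplus f' (gscal a g')).
Proof. apply grid_ext. intros. unfold gplus, gscal, gminus. ring. Qed.

Lemma compact_zero hx hy Mx My m n : Hx hx Mx (Hy hy My (fun _ _ => 0)) m n = 0.
Proof.
unfold Hx, Hy, dx2, dy2, Rdiv.
destruct (_ && _)%bool; destruct (_ && _)%bool; ring.
Qed.

Lemma adi_step_minus alpha lambda1 lambda2 beta hx hy Mx My t F V V' i m n :
  adi_step alpha lambda1 lambda2 beta hx hy Mx My t F V i m n ->
  adi_step alpha lambda1 lambda2 beta hx hy Mx My t F V' i m n ->
  adi_step alpha lambda1 lambda2 beta hx hy Mx My t (fun _ _ _ => 0)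
    (fun k => gminus (V k) (V' k)) i m n.
Proof.
unfold adi_step; cbv zeta.
intros H H'.
rewrite compact_zero.
rewrite !dx2_minus, !dy2_minus, !Hx_minus, !Hy_minus, !combination_minus,
  !dx2_minus, !Hx_minus, !combination_minus.
unfold gminus at 1. rewrite H, H'.
fold (Sum i (fun k => (w_coef alpha t i k - w_coef alpha t i (k - 1))
  * Hx hx Mx (Hy hy My (gminus (V k) (V' k))) m n)).
rewrite (Sum_ext i _ (fun k =>
  (w_coef alpha t i k - w_coef alpha t i (k - 1)) * Hx hx Mx (Hy hy My (V k)) m n
  + - 1 * ((w_coef alpha t i k - w_coef alpha t i (k - 1))
           * Hx hx Mx (Hy hy My (V' k)) m n))).
- rewrite Sum_plus, Sum_scal. unfold gminus, Sum, Rdiv. ring.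
- intros k _. rewrite Hy_minus, Hx_minus. unfold gminus. ring.
Qed.

(** Transforming the scheme replaces each difference operator by its
    eigenvalue. *)
Lemma mode_equation alpha lambda1 lambda2 beta hx hy Mx My t Z i p q :
  (0 < Mx)%nat -> (0 < My)%nat ->
  (forall k, (k <= S i)%nat -> vanishes Mx My (Z k)) ->
  (forall m n, Defs.interior Mx My m n ->
    adi_step alpha lambda1 lambda2 beta hx hy Mx My t (fun _ _ _ => 0) Z i m n) ->
  let sg := sig alpha in
  let mu := mu_coef alpha beta t i in
  let w := w_coef alpha t i in
  let a := mode_eigenvalue Mx p hx in
  let b := mode_eigenvalue My q hy in
  let cx := compact_symbol Mx p hx in
  let cy := compact_symbol My q hy in
  let z k := dst2 Mx My p q (Z k) in
  (cx + sg * lambda1 / mu * a) * ((cy + sg * lambda2 / mu * b) * z (S i))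
  = 1 / mu * Sum i (fun k => (w k - w (k - 1)%nat) * (cx * (cy * z k)))
    + w 0%nat / mu * (cx * (cy * z 0%nat))
    - beta * (1 - sg) / mu * (cx * (cy * z i))
    - (1 - sg) / mu * (lambda1 * (cy * (a * z i)) + lambda2 * (cx * (b * z i)))
    + lambda1 * lambda2 * sg ^ 2 / mu ^ 2 * (a * (b * z i)).
Proof.
intros HMx HMy Hb Hstep sg mu w a b cx cy z.
unfold adi_step in Hstep. cbv zeta in Hstep. fold sg mu w in Hstep.
assert (HH : forall k, (k <= S i)%nat ->
  dst2 Mx My p q (Hx hx Mx (Hy hy My (Z k))) = cx * (cy * z k)).
{ intros k Hk. specialize (Hb k Hk).
  rewrite dst2_Hx, dst2_Hy; auto using vanishes_x_Hy, vanishes_vanishes_y. }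
assert (HL : dst2 Mx My p q
  (gplus (Hx hx Mx (gplus (Hy hy My (Z (S i)))
       (gscal (- (sg * lambda2 / mu)) (dy2 hy (Z (S i))))))
     (gscal (- (sg * lambda1 / mu)) (dx2 hx
        (gplus (Hy hy My (Z (S i))) (gscal (- (sg * lambda2 / mu)) (dy2 hy (Z (S i)))))))) =
  (cx + sg * lambda1 / mu * a) * ((cy + sg * lambda2 / mu * b) * z (S i))).
{ specialize (Hb (S i) ltac:(lia)).
  rewrite dst2_combination, dst2_Hx, dst2_dx2
    by auto using vanishes_x_combination, vanishes_x_Hy, vanishes_x_dy2.
  rewrite dst2_combination, dst2_Hy, dst2_dy2
    by auto using vanishes_vanishes_y.
  fold a b cx cy (z (S i)). ring. }
rewrite <- HL, (dst2_ext _ _ _ _ _ _ Hstep). clear HL.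
assert (Hbi := Hb i ltac:(lia)).
rewrite (dst2_ext _ _ _ _ _ (fun m n =>
  1 / mu * Sum i (fun k => (w k - w (k - 1)%nat) * Hx hx Mx (Hy hy My (Z k)) m n)
  + w 0%nat / mu * Hx hx Mx (Hy hy My (Z 0%nat)) m n
  + - (beta * (1 - sg) / mu) * Hx hx Mx (Hy hy My (Z i)) m n
  + (1 - sg) / mu * lambda1 * Hy hy My (dx2 hx (Z i)) m n
  + (1 - sg) / mu * lambda2 * Hx hx Mx (dy2 hy (Z i)) m n
  + lambda1 * lambda2 * sg ^ 2 / mu ^ 2 * dx2 hx (dy2 hy (Z i)) m n)).
2:{ intros m n [Hm Hn].
  rewrite compact_zero. unfold Sum, Rdiv. ring. }
rewrite !(dst2_plus Mx My p q).
rewrite !(dst2_scal Mx My p q).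
rewrite (dst2_Sum Mx My p q _ (fun k => Hx hx Mx (Hy hy My (Z k)))).
rewrite !HH by lia.
rewrite (Sum_ext i _ (fun k => (w k - w (k - 1)%nat) * (cx * (cy * z k))))
  by (intros k Hk; rewrite HH by lia; reflexivity).
rewrite dst2_Hy, dst2_Hx, !dst2_dx2, dst2_dy2
  by auto using vanishes_y_dx2, vanishes_x_dy2, vanishes_vanishes_x, vanishes_vanishes_y.
fold a b cx cy (z i). unfold Rdiv. ring.
Qed.

(** * Stability *)

Lemma norm2_le_modes hx hy Mx My f g : 0 < hx -> 0 < hy ->
  (0 < Mx)%nat -> (0 < My)%nat ->
  (forall p q, Rabs (dst2 Mx My p q f) <= Rabs (dst2 Mx My p q g)) ->
  norm2 hx hy Mx My f <= norm2 hx hy Mx My g.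
Proof.
intros Hhx Hhy HMx HMy H.
assert (Hn : forall u, norm2 hx hy Mx My u
  = sqrt (hx * hy * Sum (Mx - 1) (fun m => Sum (My - 1) (fun n => u m n ^ 2)))).
{ intros u. unfold norm2. f_equal. rewrite <- Sum_scal. apply Sum_ext. intros m _.
  rewrite <- Sum_scal. apply Sum_ext. intros n _. now rewrite pow2_abs. }
rewrite !Hn. apply sqrt_le_1_alt, Rmult_le_compat_l; [nra|].
assert (0 < INR Mx / 2 * (INR My / 2)).
{ apply Rmult_lt_0_compat; apply Rdiv_lt_0_compat; try lra; now apply lt_0_INR. }
apply Rmult_le_reg_l with (INR Mx / 2 * (INR My / 2)); [assumption|].
rewrite <- !dst2_parseval. apply Sum_le. intros p _. apply Sum_le. intros q _.
rewrite <- !Rsqr_pow2. now apply Rsqr_le_abs_1.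
Qed.

(** Multiplying the equation of a mode by mu = beta sg + w_i brings it to the form
    of [implicit_step_bound], with c w_i as the weight, K = beta c + (diffusion), and
    s the product of the two directional terms, where c = c_x c_y. *)
Lemma mode_step_bound alpha lambda1 lambda2 beta hx hy Mx My t Z i p q B :
  0 < alpha < 1 -> 0 < lambda1 -> 0 < lambda2 -> 0 <= beta ->
  hx <> 0 -> hy <> 0 -> (0 < Mx)%nat -> (0 < My)%nat ->
  (forall l, (l <= i)%nat -> t l < t (S l)) ->
  (forall l, (1 <= l < i)%nat -> 3 / 4 <= eta t l) ->
  (forall k, (k <= S i)%nat -> vanishes Mx My (Z k)) ->
  (forall m n, Defs.interior Mx My m n ->
    adi_step alpha lambda1 lambda2 beta hx hy Mx My t (fun _ _ _ => 0) Z i m n) ->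
  (forall k, (k <= i)%nat -> Rabs (dst2 Mx My p q (Z k)) <= B) ->
  Rabs (dst2 Mx My p q (Z (S i))) <= B.
Proof.
intros Ha Hl1 Hl2 Hbeta Hhx Hhy HMx HMy Hinc Heta Hb Hstep HB.
assert (Heq := mode_equation _ _ _ _ _ _ _ _ _ _ _ p q HMx HMy Hb Hstep).
cbv beta zeta in Heq.
set (z := fun k => dst2 Mx My p q (Z k)).
change (Rabs (z (S i)) <= B).
assert (Hz : forall k, (k <= i)%nat -> Rabs (z k) <= B) by exact HB.
change (dst2 Mx My p q (Z (S i))) with (z (S i)) in Heq.
change (dst2 Mx My p q (Z i)) with (z i) in Heq.
change (dst2 Mx My p q (Z 0%nat)) with (z 0%nat) in Heq.
set (w := w_coef alpha t i) in *.
assert (Hw : 0 < w i) by now apply w_coef_pos.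
assert (Hsum := weighted_history_bound w z B i).
assert (Ha' := mode_eigenvalue_nonneg Mx p hx Hhx).
assert (Hb' := mode_eigenvalue_nonneg My q hy Hhy).
assert (Hcx := compact_symbol_pos Mx p hx Hhx).
assert (Hcy := compact_symbol_pos My q hy Hhy).
set (a := mode_eigenvalue Mx p hx) in *. set (b := mode_eigenvalue My q hy) in *.
set (cx := compact_symbol Mx p hx) in *. set (cy := compact_symbol My q hy) in *.
(* Otherwise [Rmult_le_pos] would unfold the symbols. *)
clearbody a b cx cy.
rewrite (Sum_ext i _ (fun k => cx * cy * ((w k - w (k - 1)%nat) * z k))) in Heq
  by (intros; unfold z; ring).
rewrite Sum_scal in Heq.
assert (Hsg : 1 / 2 <= sig alpha <= 1) by (unfold sig; lra).
assert (Hmu : mu_coef alpha beta t i = beta * sig alpha + w i) by reflexivity.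
set (mu := mu_coef alpha beta t i) in *. set (sg := sig alpha) in *.
assert (Hmu0 : 0 < mu) by (rewrite Hmu; nra).
set (A := Sum i (fun k => (w k - w (k - 1)%nat) * z k)) in *.
assert (Hc : 0 < cx * cy) by now apply Rmult_lt_0_compat.
apply (implicit_step_bound (cx * cy * w i) sg
  (beta * (cx * cy) + (lambda1 * a * cy + lambda2 * b * cx))
  (sg ^ 2 * (lambda1 * a) * (lambda2 * b) / mu)
  (cx * cy * (A + w 0%nat * z 0%nat)) _ (z i) B).
- now apply Rmult_lt_0_compat.
- exact Hsg.
- repeat (apply Rplus_le_le_0_compat || apply Rmult_le_pos); lra.
- apply Rmult_le_pos; [|left; now apply Rinv_0_lt_compat].
  repeat apply Rmult_le_pos; try lra; apply pow2_ge_0.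
- rewrite Rabs_mult, (Rabs_pos_eq (cx * cy)), (Rmult_assoc (cx * cy) (w i)) by lra.
  apply Rmult_le_compat_l; [lra|]. apply Hsum; [| |exact Hz].
  + left. apply w_coef_pos; auto; lia.
  + intros k Hk. now apply w_coef_increasing.
- apply Hz. lia.
- transitivity (mu * ((cx + sg * lambda1 / mu * a)
                      * ((cy + sg * lambda2 / mu * b) * z (S i)))).
  + replace (w i) with (mu - beta * sg) by lra. field. lra.
  + apply (Rmult_eq_compat_l mu) in Heq. etransitivity; [exact Heq|]. field. lra.
Qed.

Theorem theorem3p2
  (alpha Tf L lambda1 lambda2 mu1 mu2 gamma : R)
  (F : R -> R -> R -> R) (phi : R -> R -> R) (psi : R -> R -> R -> R)
  (c0 Cq theta T : R) (Nt Nhat : nat) (t : nat -> R) (Mx My : nat)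
  (Halpha : 0 < alpha < 1) (HTf : 0 < Tf) (HL : 0 < L)
  (Hlambda1 : 0 < lambda1) (Hlambda2 : 0 < lambda2)
  (Hbeta : 0 <= reaction_coef lambda1 lambda2 mu1 mu2 gamma)
  (Hc0 : 0 < c0 < 1) (Htheta : 1 <= theta)
  (Hmesh : temporal_mesh c0 Cq theta T Tf Nt Nhat t)
  (Hratio : mesh_ratio_conditions Nt t)
  (HMx : (0 < Mx)%nat) (HMy : (0 < My)%nat) :
  let beta := reaction_coef lambda1 lambda2 mu1 mu2 gamma in
  let hx := L / INR Mx in
  let hy := L / INR My in
  forall (phi' : R -> R -> R) (V V' : nat -> grid),
    adi_solution alpha lambda1 lambda2 beta hx hy Mx My Nt t F phi psi V ->
    adi_solution alpha lambda1 lambda2 beta hx hy Mx My Nt t F phi' psi V' ->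
    let zeta : nat -> grid := fun i m n => V i m n - V' i m n in
    (forall i m n, (i <= Nt)%nat -> boundary Mx My m n -> zeta i m n = 0) ->
    forall i, (i <= Nt - 1)%nat ->
      norm2 hx hy Mx My (zeta (S i)) <= norm2 hx hy Mx My (zeta 0%nat).
Proof.
intros beta hx hy phi' V V' HV HV' zeta Hzeta i Hi.
assert (Hhx : 0 < hx) by (apply Rdiv_lt_0_compat; [exact HL | now apply lt_0_INR]).
assert (Hhy : 0 < hy) by (apply Rdiv_lt_0_compat; [exact HL | now apply lt_0_INR]).
assert (HNt := mesh_Nt_pos _ _ _ _ _ _ _ _ Hmesh).
assert (Hinc := temporal_mesh_increasing _ _ _ _ _ _ _ _ Htheta Hmesh).
apply norm2_le_modes; auto. intros p q.
cut (forall j, (j <= Nt)%nat ->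
  Rabs (dst2 Mx My p q (zeta j)) <= Rabs (dst2 Mx My p q (zeta 0%nat))).
{ intros H. apply H. lia. }
intros j. induction j as [[|j] IH] using lt_wf_ind; intros Hj; [lra|].
apply (mode_step_bound alpha lambda1 lambda2 beta hx hy Mx My t); auto; try lra.
- intros l Hl. apply Hinc. lia.
- intros l Hl. apply (proj1 Hratio). lia.
- intros k Hk m n. apply Hzeta. lia.
- intros m n Hmn. apply (adi_step_minus _ _ _ _ _ _ _ _ _ F V V').
  + apply (adi_interior _ _ _ _ _ _ _ _ _ _ _ _ _ _ HV); [lia | exact Hmn].
  + apply (adi_interior _ _ _ _ _ _ _ _ _ _ _ _ _ _ HV'); [lia | exact Hmn].
- intros k Hk. apply IH; lia.
Qed.
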